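(* Let $\Phi$ be a stationary point process on $\mathbf{R}^N$ having all finite moments. For $\varepsilon>0$ and $(b,d)\in\Delta$ let $$A_{q,\varepsilon,(b,d)}:=\bigcup_{M=1}^\infty\{\Phi_{\Lambda_M}\text{ is a }B_\varepsilon((b,d))\text{-marker in }\Lambda_M\text{ for the }q\text{th persistent homology}\},$$ and $$S_{q,\varepsilon}:=\{(b,d)\in\Delta:\mathbb{P}(A_{q,\varepsilon,(b,d)})>0\},\qquad S_q:=\bigcap_{\varepsilon>0}S_{q,\varepsilon}.$$ Then $S_q\subset\operatorname{supp}\nu_q$.
   Context: Fix integers $N\ge 1$, $q\ge 0$ and a field $\mathbf{F}$; all homology is simplicial homology with coefficients in $\mathbf{F}$. The function $\kappa$. Let $\mathscr{F}(\mathbf{R}^N)$ be the set of all nonempty finite subsets of $\mathbf{R}^N$. A function $f$ on $\mathscr{F}(\mathbf{R}^N)$ is measurable if for each $k\ge1$ the permutation-invariant function $(x_1,\dots,x_k)\mapsto f(\{x_1,\dots,x_k\})$ on $(\mathbf{R}^N)^k$ is measurable. Fix a measurable function $\kappa:\mathscr{F}(\mathbf{R}^N)\to[0,\infty]$ such that: (K1) $0\le\kappa(\sigma)\le\kappa(\tau)$ if $\sigma\subset\tau$; (K2) $\kappa(\sigma+x)=\kappa(\sigma)$ for all $x\in\mathbf{R}^N$; (K3) there is an increasing function $\rho:[0,\infty]\to[0,\infty]$ with $\rho(t)<\infty$ for $t<\infty$ such that $\|x-y\|\le\rho(\kappa(\{x,y\}))$ for all $x,y$ (Euclidean norm); normalized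 by $\kappa(\{x\})=0$. The filtration. For a finite set $\Xi\subset\mathbf{R}^N$ and $t\ge 0$, let $K(\Xi,t)$ be the simplicial complex of all nonempty $\sigma\subset\Xi$ with $\kappa(\sigma)\le t$. Persistence diagram. The persistent homology $(H_q(K(\Xi,t)))_{t\ge 0}$ with the maps induced by inclusions decomposes uniquely as $\bigoplus_{i=1}^{p} I(b_i,d_i)$ with $0\le b_i<d_i\le\infty$, where $I(b,d)$ is $\mathbf{F}$ at parameters $b\le t<d$ (with identity maps between them) and $0$ otherwise. Let $\Delta=\{(x,y)\in[0,\infty]^2: 0\le x<y\le\infty\}$ (with the subspace topology from $[0,\infty]^2$) and $\xi_q(\Xi)=\sum_{i=1}^p\delta_{(b_i,d_i)}$. $B_\varepsilon((b,d))\subset\Delta$ is the open $\varepsilon$-neighborhood of $(b,d)$ with respect to a fixed metric inducing the topology of $\Delta$. Markers. Let $\Lambda\subset\mathbf{R}^N$ be a bounded Borel set and $(b,d)\in\Delta$. A set $\Xi\in\mathscr{F}(\mathbf{R}^N)$ is a $(b,d)$-marker in $\Lambda$ for the $q$th persistent homology if (i) $\Xi\subset\Lambda$ and (ii) for every $\Psi\in\mathscr{F}(\mathbf{R}^N)$, $\xi_q(\Psi_{\Lambda^c}\sqcup\Xi)(\{(b,d)\})\ge\xi_q(\Psi_{\Lambda^c})(\{(b,d)\})+1$, where $\Psi_{\Lambda^c}=\Psi\setminus\Lambda$. For $A\subset\Delta$, $\Xi$ is an $A$-marker in $\Lambda$ if it is a $(b,d)$-marker in $\Lambda$ for some $(b,d)\in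 A$. Point processes. A point process $\Phi$ on $\mathbf{R}^N$ is a random integer-valued Radon measure; it is always assumed simple (almost surely $\Phi(\{x\})\le1$ for every $x$) and identified with its set of points. It is stationary if its law is translation invariant, and has all finite moments if $\mathbb{E}[\Phi(A)^k]<\infty$ for all bounded Borel $A$ and $k=1,2,\dots$. $\Phi_\Lambda$ is the restriction of $\Phi$ to $\Lambda$, and $\Lambda_L=[-\frac L2,\frac L2)^N$. The measure $\nu_q$. With $\xi_{q,L}=\xi_q(\Phi_{\Lambda_L})$, $\nu_q$ is the unique Radon measure on $\Delta$ such that $L^{-N}\mathbb{E}[\xi_{q,L}]\to\nu_q$ vaguely as $L\to\infty$ (i.e. integrals of continuous compactly supported functions on $\Delta$ converge); it exists for every stationary $\Phi$ with all finite moments. *)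

(* Defs.v *)
From HB Require Import structures.
From mathcomp Require Import all_boot all_order all_algebra.

Set Implicit Arguments.
Unset Strict Implicit.
Unset Printing Implicit Defensive.

Import Order.TTheory GRing.Theory Num.Theory.
Local Open Scope ring_scope.

Section SimplicialHomology.
Variables (F : fieldType) (X : finType) (lt : rel X).

(* The formal basis vectors are indexed by all subsets of X, so that every
   chain space of every complex on X is a subspace of one space. *)
Definition chain := {ffun {set X} -> F^o}.

Definition basis_chain (s : {set X}) : chain := [ffun u => (u == s)%:R].

(* The sign is that of [v_0, ..., v_q] |-> (-1)^i [v_0, .., ^v_i, .., v_q] for
   vertices listed in lt-increasing order: i counts the vertices below v_i.
   The empty set is not a simplex, hence the boundary of a vertex is 0
   (unreduced homology). *)
Definition boundary_simplex (s : {set X}) : chain :=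
  \sum_(v in s | s :\ v != set0)
    (-1) ^+ #|[set w in s | lt w v]| *: basis_chain (s :\ v).

Definition boundary : 'End(chain) :=
  linfun (fun c : chain => \sum_s c s *: boundary_simplex s).

Variable K : {set {set X}}.

Definition chains (q : nat) : {vspace chain} :=
  <<[seq basis_chain s | s in [set s in K | #|s| == q.+1]]>>%VS.

Definition cycles (q : nat) : {vspace chain} :=
  (chains q :&: lker boundary)%VS.

Definition boundaries (q : nat) : {vspace chain} :=
  (boundary @: chains q.+1)%VS.

End SimplicialHomology.

Section Quotient.
Variables (F : fieldType) (vT : vectType F).

(* The quotient of vT by B is realised on the complement B^C: the class of v
   is its projection to B^C along B, a linear map with kernel exactly B. *)
Definition class_mod (B : {vspace vT}) : 'End(vT) := daddv_pi (B^C)%VS B.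

Definition quotv (Z B : {vspace vT}) : vectType F :=
  subvs_of (class_mod B @: Z)%VS.

(* The map z + B |-> z + B' from Z / B to Z' / B', for Z <= Z' and B <= B'. *)
Definition quotv_map (Z B Z' B' : {vspace vT}) :
    'Hom(quotv Z B, quotv Z' B') :=
  linfun (fun x : subvs_of (class_mod B @: Z)%VS =>
    vsproj (class_mod B' @: Z')%VS (class_mod B' (vsval x))).

End Quotient.

From mathcomp Require Import finmap.
From mathcomp Require Import all_classical all_reals all_analysis measurable_realfun.
Import numFieldNormedType.Exports.
Local Open Scope classical_set_scope.
Local Open Scope ring_scope.

Section PersistenceModules.
Variables (R : realType) (F : fieldType).

(* Only the parameters 0 <= t and the maps with 0 <= s <= t are relevant. *)
Record persmod := Persmod {
  pm_space : R -> vectType F;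
  pm_map : forall s t : R, 'Hom(pm_space s, pm_space t) }.

Definition pm_iso (U V : persmod) : Prop :=
  exists phi : forall t : R, 'Hom(pm_space U t, pm_space V t),
    (forall t, 0 <= t -> bijective (phi t)) /\
    (forall s t, 0 <= s -> s <= t -> forall x : pm_space U s,
       phi t (pm_map U s t x) = pm_map V s t (phi s x)).

Definition pm_zero : persmod :=
  @Persmod (fun _ => subvs_of (0%VS : {vspace F^o})) (fun _ _ => \1%VF).

Definition pm_sum (U V : persmod) : persmod :=
  @Persmod (fun t => (pm_space U t * pm_space V t)%type)
    (fun s t => linfun (fun x : pm_space U s * pm_space V s =>
                  (pm_map U s t x.1, pm_map V s t x.2))).

Definition interval_fiber (b d : \bar R) (t : R) : {vspace F^o} :=
  if ((b <= t%:E) && (t%:E < d))%E then fullv else 0%VS.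

(* vsproj is the identity onto the full space and zero onto the zero space. *)
Definition interval_mod (b d : \bar R) : persmod :=
  @Persmod (fun t => subvs_of (interval_fiber b d t))
    (fun s t => linfun (fun x : subvs_of (interval_fiber b d s) =>
                  vsproj (interval_fiber b d t) (vsval x))).

Definition interval_sum (D : seq (\bar R * \bar R)) : persmod :=
  foldr (fun p M => pm_sum (interval_mod p.1 p.2) M) pm_zero D.

End PersistenceModules.

Section Delta.
Variable R : realType.

Definition Delta_set : set (\bar R * \bar R) :=
  [set p | (0 <= p.1)%E /\ (p.1 < p.2)%E].

(* As a set_type, Delta carries the subspace topology of \bar R * \bar R. *)
Definition Delta : Type := set_type Delta_set.

HB.instance Definition _ := Topological.copy Delta (set_type Delta_set).

Let zero_one : Delta_set (0%E, 1%E).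
Proof. by split => /=; rewrite ?lee_fin ?lte_fin ?ltr01. Qed.

HB.instance Definition _ := isPointed.Build Delta (SigSub (mem_set zero_one)).

Definition birth (p : Delta) : \bar R := (set_val p).1.
Definition death (p : Delta) : \bar R := (set_val p).2.

Definition borel_Delta := g_sigma_algebraType (@open Delta).

Definition metric_on_Delta (dist : Delta -> Delta -> R) : Prop :=
  [/\ forall x y, 0 <= dist x y,
      forall x y, dist x y = 0 <-> x = y,
      forall x y, dist x y = dist y x,
      forall x y z, dist x z <= dist x y + dist y z &
      forall (x : Delta) (U : set Delta),
        nbhs x U <-> exists2 e, 0 < e & [set y | dist x y < e] `<=` U].

Definition radon (nu : {measure set borel_Delta -> \bar R}) : Prop :=
  forall C : set Delta, compact C -> (nu C < +oo)%E.

Definition supp (nu : {measure set borel_Delta -> \bar R}) : set Delta :=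
  [set p | forall U : set Delta, open U -> U p -> (0 < nu U)%E].

End Delta.

Section Filtration.
Variables (R : realType) (N : nat).

Local Notation E := 'rV[R]_N.

Definition euclidean_norm (x : E) : R := Num.sqrt (\sum_i x ord0 i ^+ 2).

Definition borel_space := g_sigma_algebraType (@open E).

Definition fin_measurable (f : {fset E} -> \bar R) : Prop :=
  forall k : nat,
    measurable_fun [set: k.+1.-tuple borel_space]
      (fun x : k.+1.-tuple borel_space => f [fset y : E in (x : seq E)]%fset).

(* Only the values of kappa at nonempty sets are constrained or used. *)
Definition admissible (kappa : {fset E} -> \bar R) : Prop :=
  [/\ fin_measurable kappa,
      forall s u : {fset E}, s != fset0 -> (s `<=` u)%fset ->
        (0 <= kappa s)%E /\ (kappa s <= kappa u)%E,
      forall (s : {fset E}) (x : E), s != fset0 ->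
        kappa [fset (y + x)%R | y in s]%fset = kappa s,
      exists rho : \bar R -> \bar R,
        [/\ forall t, (0 <= t)%E -> (0 <= rho t)%E,
            forall s t, (0 <= s)%E -> (s <= t)%E -> (rho s <= rho t)%E,
            forall t, (0 <= t < +oo)%E -> (rho t < +oo)%E &
            forall x y : E,
              ((euclidean_norm (x - y))%:E <= rho (kappa [fset x; y]%fset))%E] &
      forall x : E, kappa [fset x]%fset = 0%E].

(* The order of R^N that orients the simplices; any other total order gives
   isomorphic homology. *)
Definition lexlt : rel E := fun x y =>
  [exists i : 'I_N, (x ord0 i < y ord0 i) &&
    [forall j : 'I_N, (j < i)%N ==> (x ord0 j == y ord0 j)]].

Variables (F : fieldType) (kappa : {fset E} -> \bar R) (q : nat).

Section FixedSet.
Variable Xi : {fset E}.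

Definition filtration (t : R) : {set {set Xi}} :=
  [set s | (s != finset.set0) && (kappa [fsetval v in s]%fset <= t%:E)%E].

Definition vertex_lt : rel Xi := fun v w => lexlt (val v) (val w).

Definition cycles_at (t : R) := cycles F vertex_lt (filtration t) q.
Definition boundaries_at (t : R) := boundaries F vertex_lt (filtration t) q.

Definition pers_homology : persmod R F :=
  @Persmod R F (fun t => quotv (cycles_at t) (boundaries_at t))
    (fun s t => quotv_map (cycles_at s) (boundaries_at s)
                          (cycles_at t) (boundaries_at t)).

(* The decomposition is unique up to the order of the intervals; xget selects
   one enumeration of it. *)
Definition diagram : seq (Delta R) :=
  xget [::] [set D : seq (Delta R) |
    pm_iso pers_homology (interval_sum F [seq (birth p, death p) | p <- D])].

(* xi_q(Xi)(A): the mass of A under the sum of the Dirac masses at the points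
   of the diagram. *)
Definition xi (A : set (Delta R)) : nat := count (fun p => p \in A) diagram.

End FixedSet.

Definition outside (L : set E) (Psi : {fset E}) : {fset E} :=
  [fset x in Psi | x \notin L]%fset.

Definition point_marker (L : set E) (p : Delta R) (Xi : {fset E}) : Prop :=
  [/\ Xi != fset0, [set` Xi] `<=` L &
      forall Psi : {fset E}, Psi != fset0 ->
        (xi (outside L Psi `|` Xi)%fset [set p] >=
           xi (outside L Psi) [set p] + 1)%N].

Definition marker (L : set E) (A : set (Delta R)) (Xi : {fset E}) : Prop :=
  exists2 p, A p & point_marker L p Xi.

End Filtration.

Section PointProcesses.
Variables (R : realType) (N : nat).
Local Notation E := 'rV[R]_N.
Local Notation BE := (borel_space R N).
Variables (d : measure_display) (T : measurableType d).
Variables (P : probability T R) (Phi : R.-ker T ~> BE).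

(* A kernel T ~> R^N is a random measure; this makes it integer-valued and
   locally finite. *)
Definition is_point_process : Prop :=
  forall w (A : set E), measurable (A : set BE) -> bounded_set A ->
    exists n : nat, Phi w A = n%:R%:E.

Definition simple_process : Prop :=
  {ae P, forall w, forall x : E, (Phi w [set x] <= 1)%E}.

(* The sigma-algebra generated by the evaluations m |-> m A at Borel sets. *)
Definition law_events : set (set (set E -> \bar R)) :=
  <<s [set C | exists (A : set E) (B : set (\bar R)),
         [/\ measurable (A : set BE), measurable B &
             C = (fun m : set E -> \bar R => m A) @^-1` B]] >>.

Definition translate_measure (x : E) (m : set E -> \bar R) : set E -> \bar R :=
  fun A => m [set y | A (y + x)].

Definition stationary : Prop :=
  forall (x : E) (H : set (set E -> \bar R)), law_events H ->
    P [set w | H (translate_measure x (Phi w))] = P [set w | H (Phi w)].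

Definition all_moments : Prop :=
  forall A : set E, measurable (A : set BE) -> bounded_set A ->
  forall k : nat, (0 < k)%N -> (\int[P]_w (Phi w A ^+ k) < +oo)%E.

Definition box (L : R) : set E :=
  [set x | forall i, - (L / 2) <= x ord0 i < L / 2].

(* Phi is identified with its set of points; the set below is finite for
   bounded L. *)
Definition points_in (L : set E) (w : T) : {fset E} :=
  fset_set [set x | L x /\ (0 < Phi w [set x])%E].

Variables (F : fieldType) (kappa : {fset E} -> \bar R) (q : nat).

(* The integral of f against E[xi_{q,L}]. *)
Definition expected_xi (L : R) (f : Delta R -> R) : \bar R :=
  (\int[P]_w (\sum_(p <- diagram F kappa q (points_in (box L) w)) f p)%:E)%E.

Definition is_limit_measure (nu : {measure set (borel_Delta R) -> \bar R}) :=
  radon nu /\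
  forall f : Delta R -> R, continuous f -> compact (closure [set p | f p != 0]) ->
    ((L ^- N)%:E * expected_xi L f)%E @[L --> +oo%R] --> (\int[nu]_p (f p)%:E)%E.

Variable dist : Delta R -> Delta R -> R.

Definition marker_event (e : R) (p : Delta R) : set T :=
  \bigcup_(M in [set M : nat | (1 <= M)%N])
    [set w | marker F kappa q (box M%:R) [set p' | dist p p' < e]
               (points_in (box M%:R) w)].

(* The quantifier over all Psi in a marker makes the event measurable only for
   the completion of P.  Its probability is taken with the outer measure of P,
   which extends P and agrees with that completion. *)
Definition S_eps (e : R) : set (Delta R) :=
  [set p | (0 < mu_ext P (marker_event e p))%E].

Definition S_q : set (Delta R) := \bigcap_(e in [set e : R | 0 < e]) S_eps e.

End PointProcesses.

(* Main.v *)
Require Import Defs.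
From HB Require Import structures.
From mathcomp Require Import all_boot all_order all_algebra.
From mathcomp Require Import finmap zify lra.
From mathcomp Require Import all_classical all_reals all_analysis measurable_realfun.

Set Implicit Arguments.
Unset Strict Implicit.
Unset Printing Implicit Defensive.

Import Order.TTheory GRing.Theory Num.Theory.
Import numFieldNormedType.Exports.

(** Let p be a point of S_q and U an open neighbourhood of p in Delta. There is a
    continuous function f with compact support in U that is at least 1 on a small
    neighbourhood A of p, which may be taken to be a rectangle of births and
    deaths, because Delta is locally compact ([bump_function]). For some M the
    configuration in the box of side M is an A-marker with positive outer
    probability c. For L = (2k+1)M the box of side L is the disjoint union of
    (2k+1)^N translates of the box of side M, its cells. A cell that contains a
    marker for a point p' of A contributes at least one to the multiplicity of p'
    in the diagram of the whole configuration, since a marker may be added to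
    anything; removing the marker cells of p' one after the other, and then
    summing over p', shows that the diagram has at least as many points in A as
    there are marker cells ([leq_relative_marker]). By stationarity the expected
    number of marker cells is at least c (2k+1)^N, so that the integral of f
    against the expected diagram, divided by L^N, is at least c / M^N for all k.
    So is its limit, the integral of f with respect to nu, and nu U > 0.

    The expected number of marker cells needs a measurable event. Being a marker
    is a condition on all configurations outside of the box, an uncountable
    intersection, and an outer probability alone would not do: outer
    probabilities neither add up nor are they preserved by stationarity. The
    counting argument, however, only tests a marker against parts of the
    configuration that is actually present. This leads to relative markers, a
    condition on the finitely many subsets of the configuration in a window. They
    are implied by markers, they suffice for the counting, and they form a
    Borel event ([measurable_relative_marker]), so that [marker_cells] applies
    stationarity to an event of the law of the process.

    To see that the event is Borel one needs the multiplicity of a point of the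
    diagram as a function of the configuration. The diagram is some interval
    decomposition of the persistent homology. Decompositions exist, since cycles
    and boundaries at the finitely many critical times are two flags of subspaces
    of one space, and two flags have a common adapted basis ([two_flags],
    [diagram_iso]). In any decomposition, the number of intervals born by s and
    alive at t is the rank of the map from the homology at s to that at t
    ([diagram_rank]). By inclusion-exclusion the multiplicity of (b, d) is an
    alternating sum of four ranks ([xi_point]), and these depend only on the order
    of the vertices and on the comparisons between b, d and the values of kappa
    on the subsets. This gives at once the measurability, the translation
    invariance, and the independence of the chosen decomposition.

    Two more facts link configurations to the process. A Borel condition on the
    labelled points is an event for the numbers of points in Borel sets, by
    Dynkin's theorem ([measurable_config]). And a simple integer-valued measure on
    a bounded set is the counting measure of its finitely many atoms
    ([counts_atoms_simple]), so that such an event can be read off from the masses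
    of Borel sets, on which stationarity is expressed ([law_event_config]). *)

Local Open Scope ring_scope.

(** * Bases adapted to two flags of subspaces *)

(** The relation says that [g] is the mixed difference of [f], so the double sum
    over a rectangle only sees the values of [f] at its four corners. It is
    arranged as an equation between sums because subtraction truncates. *)
Lemma telescope_rectangle (f g : nat -> nat -> nat) :
  (forall i j, (g i j + f i j.+1 + f i.+1 j = f i.+1 j.+1 + f i j)%N) ->
  forall a b c, (b <= c)%N ->
  (\sum_(0 <= i < a) \sum_(b <= j < c) g i j + f a b + f 0 c
     = f a c + f 0 b)%N.
Proof.
move=> fg a b c bc.
have row i : (\sum_(b <= j < c) g i j + f i c + f i.+1 b = f i.+1 c + f i b)%N.
  rewrite -(subnKC bc); elim: (c - b)%N => [|k IH].
    by rewrite addn0 big_geq// addnC.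
  by rewrite addnS big_nat_recr ?leq_addr//=; have := fg i (b + k)%N; lia.
elim: a => [|a IH]; first by rewrite big_geq //; lia.
by rewrite big_nat_recr //=; have := row a; lia.
Qed.

Section TwoFlags.
Variables (F : fieldType) (vT : vectType F).

(** Two flags of subspaces are always spanned by parts of one common family of
    vectors. For each pair (i, j) choose a complement [E i j], inside the
    intersection of [Z i] and [B j], of what comes from [Z i.-1] or from
    [B j.-1]; the family consists of bases of these complements. An entry
    [(e, (i, j))] thus enters the first flag at step [i] and the second one at
    step [j], where [j = n.+1] stands for never, and the entries with
    [i <= m < j] give a basis of [Z m] modulo [B m]. Independence comes from
    the dimension count of [telescope_rectangle]. *)
Lemma two_flags (n : nat) (Z B : nat -> {vspace vT}) :
  (forall i j, (i <= j)%N -> (Z i <= Z j)%VS) ->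
  (forall i j, (i <= j)%N -> (B i <= B j)%VS) ->
  exists l : seq (vT * (nat * nat)),
    (forall x, x \in l -> [/\ (x.2.1 < x.2.2)%N, (x.2.1 <= n)%N, x.1 \in Z x.2.1,
       (x.2.2 <= n.+1)%N & (x.2.2 <= n)%N -> x.1 \in B x.2.2]) /\
    forall m, (m <= n)%N ->
      (Z m <= <<[seq x.1 | x <- l & (x.2.1 <= m < x.2.2)%N]>> + B m)%VS /\
      (\dim (Z m) = count (fun x => (x.2.1 <= m < x.2.2)%N) l
                    + \dim (Z m :&: B m))%N.
Proof.
move=> Zmono Bmono.
(* The flags are shifted by one, so that index 0 stands for the zero space; beyond
   [n] the second flag is completed by the whole space. *)
pose Zp i := if i is i'.+1 then Z i' else 0%VS.
pose Bp j := if j is j'.+1 then (if (j' <= n)%N then B j' else fullv) else 0%VS.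
have Zpm i j : (i <= j)%N -> (Zp i <= Zp j)%VS.
  by case: i j => [|i] [|j] //= ij; rewrite ?sub0v ?subvv//; apply: Zmono.
have Bpm i j : (i <= j)%N -> (Bp i <= Bp j)%VS.
  case: i j => [|i] [|j] //=; rewrite ?sub0v ?subvv// ltnS => ij.
  case: (leqP j n) => jn; last by rewrite subvf.
  by rewrite (leq_trans ij jn); apply: Bmono.
pose G i j := (Zp i :&: Bp j)%VS.
pose E i j := (G i.+1 j.+1 :\: (G i j.+1 + G i.+1 j))%VS.
have GS i j : (G i j.+1 + G i.+1 j <= G i.+1 j.+1)%VS.
  by rewrite subv_add; apply/andP; split; apply: capvS => //;
    by [apply: Zpm|apply: Bpm].
have GE i j : (G i.+1 j.+1 = G i j.+1 + G i.+1 j + E i j)%VS.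
  by rewrite addvC addv_diff; apply/esym/addv_idPl.
have dimE i j : (\dim (E i j) + \dim (G i j.+1) + \dim (G i.+1 j)
    = \dim (G i.+1 j.+1) + \dim (G i j))%N.
  have := dimv_cap_compl (G i.+1 j.+1) (G i j.+1 + G i.+1 j)%VS.
  rewrite (capv_idPr (GS i j)) -/(E i j).
  have := dimv_sum_cap (G i j.+1) (G i.+1 j).
  have -> : (G i j.+1 :&: G i.+1 j = G i j)%VS.
    apply: subv_anti; apply/andP; split.
      by apply: capvS; [exact: capvSl|exact: capvSr].
    by rewrite subv_cap; apply/andP; split; apply: capvS => //;
      by [apply: Zpm|apply: Bpm].
  lia.
pose prs := [seq ij <- [seq (i, j) | i <- iota 0 n.+1, j <- iota 0 n.+2]
               | (ij.1 < ij.2)%N].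
have inprs i j : ((i, j) \in prs) = [&& i < j, i <= n & j <= n.+1]%N.
  rewrite mem_filter; congr andb; apply/allpairsP/andP => [[[a b]]|[ia jb]].
    by case; rewrite !mem_iota !add0n => ia jb [-> ->].
  by exists (i, j); rewrite !mem_iota !add0n.
pose l := flatten [seq [seq (e, ij) | e <- vbasis (E ij.1 ij.2)] | ij <- prs].
have inl e i j : (i < j)%N -> (i <= n)%N -> (j <= n.+1)%N -> e \in vbasis (E i j) ->
    (e, (i, j)) \in l.
  move=> ij iN jN eE; apply/flatten_mapP; exists (i, j).
    by rewrite inprs ij iN.
  by apply/mapP; exists e.
exists l; split=> [x|m mn].
  case/flatten_mapP => -[i j]; rewrite inprs => /and3P[ij iN jN].
  case/mapP => e /= /vbasis_mem eE -> /=.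
  have : e \in G i.+1 j.+1 by apply: (subvP (diffvSl _ _)) eE.
  by rewrite memv_cap /= => /andP[eZ eB]; split => // jn; move: eB; rewrite jn.
split.
  set W := (_ + B m)%VS.
  suff GW i j : (i <= m.+1)%N -> (j <= n.+2)%N -> (G i j <= W)%VS.
    by have := GW m.+1 n.+2 (leqnn _) (leqnn _); rewrite /G /= ltnn capvf.
  elim: i j => [|i IHi] j; first by rewrite /G cap0v sub0v.
  elim: j => [|j IHj] im jn; first by rewrite /G capv0 sub0v.
  rewrite GE !subv_add IHj ?(ltnW jn)// IHi ?(ltnW im)//=.
  have [mj|jm] := ltnP m j.
    apply: subv_trans (addvSl _ _); rewrite -(span_basis (vbasisP (E i j))).
    apply: sub_span => e eE; apply/mapP; exists (e, (i, j)) => //.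
    by rewrite mem_filter /= mj -ltnS im /= inl //; lia.
  apply: subv_trans (diffvSl _ _) _; apply: subv_trans (capvSr _ _) _.
  apply: subv_trans (addvSr _ _); have jn' : (j <= n)%N by lia.
  by rewrite /= jn'; apply: Bmono.
have := telescope_rectangle dimE m.+1 (_ : m.+1 <= n.+2)%N.
have G0 j : \dim (G 0%N j) = 0%N by rewrite /G cap0v dimv0.
rewrite !G0 !addn0 => /(_ (leqW mn)).
rewrite /G /= ltnn capvf mn => <-; congr addn.
rewrite count_flatten -map_comp sumnE big_map big_filter.
rewrite (eq_bigr (fun ij => if (ij.1 <= m < ij.2)%N then \dim (E ij.1 ij.2) else 0%N)); last first.
  move=> [i j] _ /=; rewrite count_map; case: ifP => h /=.
    by rewrite (eq_count (a2 := predT)) ?count_predT ?size_tuple.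
  by rewrite (eq_count (a2 := pred0)) ?count_pred0.
rewrite [RHS]big_mkcond big_allpairs_dep.
rewrite (big_nat_widen _ _ n.+1) ?ltnS// [LHS]big_mkcond.
rewrite /index_iota !subn0; apply: eq_bigr => i _.
rewrite ltnS; case: (leqP i m) => im; last first.
  by rewrite [RHS]big1 // => j _; case: ifP.
rewrite (big_nat_widenl _ 0) // big_mkcond /index_iota subn0.
apply: eq_bigr => j _ /=.
by case: (ltnP m j) => mj; rewrite ?(leq_ltn_trans im mj) //; case: ifP.
Qed.
End TwoFlags.

(** * Persistence modules of subquotients and sums of intervals *)

Lemma linfunE (F : fieldType) (aT rT : vectType F) (f : aT -> rT) x :
  linear f -> linfun f x = f x.
Proof.
move=> fL; pose fl := GRing.isSemilinear.Build F aT rT _ f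
  (GRing.semilinear_linear fL).
pose g : {linear aT -> rT} := HB.pack f fl.
exact: (lfunE g x).
Qed.

Section Classes.
Variables (F : fieldType) (vT : vectType F).
Implicit Types Z B : {vspace vT}.

(** [class_mod B] is a projection along [B], hence it changes a vector only by an
    element of [B]. *)
Lemma class_mod_sub B v : v - class_mod B v \in B.
Proof.
rewrite -{1}(@daddv_pi_add _ _ (B^C)%VS B v).
- by rewrite addrC addKr memv_pi.
- by rewrite capvC capv_compl.
- by rewrite addvC addv_complf memvf.
Qed.

Lemma lker_class_mod B : lker (class_mod B) = B.
Proof.
apply/vspaceP => v; rewrite memv_ker; apply/eqP/idP => [v0|vB].
  by have := class_mod_sub B v; rewrite v0 subr0.
have : class_mod B v \in (B :&: B^C)%VS.
  rewrite memv_cap memv_pi andbT -[class_mod B v](subKr v).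
  by rewrite rpredB // class_mod_sub.
by rewrite capv_compl memv0 => /eqP.
Qed.

Lemma class_mod_eq B u v : (u - v \in B) = (class_mod B u == class_mod B v).
Proof. by rewrite -{1}(lker_class_mod B) memv_ker linearB subr_eq0. Qed.

Lemma class_mod_comp B B' v : (B <= B')%VS ->
  class_mod B' (class_mod B v) = class_mod B' v.
Proof.
move=> BB'; apply/esym/eqP; rewrite -class_mod_eq.
exact: (subvP BB') (class_mod_sub B v).
Qed.

Lemma dim_class_mod Z B :
  (\dim (class_mod B @: Z) + \dim (Z :&: B) = \dim Z)%N.
Proof. by rewrite -(limg_ker_dim (class_mod B) Z) lker_class_mod addnC. Qed.

Lemma quotv_mapE Z B Z' B' (x : quotv Z B) :
  (Z <= Z')%VS -> (B <= B')%VS ->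
  vsval (quotv_map Z B Z' B' x) = class_mod B' (vsval x).
Proof.
move=> ZZ' BB'; rewrite linfunE ?vsprojK //.
have /memv_imgP[z zZ ->] := subvsP x.
  by rewrite class_mod_comp // memv_img // (subvP ZZ').
by move=> k u v; rewrite !linearP.
Qed.

(** The rank of the induced map is a difference of dimensions of subspaces of the
    ambient space; this is what makes ranks computable from the complexes. *)
Lemma dim_limg_quotv_map Z B Z' B' : (Z <= Z')%VS -> (B <= B')%VS ->
  (\dim (limg (quotv_map Z B Z' B')) + \dim (Z :&: B') = \dim Z)%N.
Proof.
move=> ZZ' BB'; rewrite -(dim_class_mod Z B'); congr addn.
pose h : 'Hom(quotv Z' B', vT) := linfun (@vsval _ _ (class_mod B' @: Z')%VS).
have hE x : h x = vsval x by rewrite lfunE.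
have h0 : lker h == 0%VS.
  by apply/lker0P => x y; rewrite !hE; exact: val_inj.
rewrite -(@limg_dim_eq _ _ _ h); last by rewrite (eqP h0) capv0.
congr (\dim _); apply/vspaceP => v; apply/memv_imgP/memv_imgP => -[x xin ->].
  have /memv_imgP[y _ ->] := xin; rewrite hE quotv_mapE //.
  have /memv_imgP[z zZ ->] := subvsP y.
  by exists z => //; rewrite class_mod_comp.
pose y : quotv Z B := vsproj _ (class_mod B x).
exists (quotv_map Z B Z' B' y); first by rewrite memv_img ?memvf.
by rewrite hE quotv_mapE // vsprojK ?memv_img // class_mod_comp.
Qed.

End Classes.

Section IntervalSums.
Variables (R : realType) (F : fieldType).

Definition alive (t : R) (p : \bar R * \bar R) : bool :=
  ((p.1 <= t%:E) && (t%:E < p.2))%E.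

Lemma dim_subvs (vT : vectType F) (U : {vspace vT}) :
  dim (subvs_of U) = \dim U.
Proof. by []. Qed.

Lemma dim_interval_fiber b d t :
  \dim (interval_fiber F b d t) = alive t (b, d) :> nat.
Proof.
rewrite /interval_fiber /alive /=; case: ifP => _; last exact: dimv0.
by rewrite dimvf.
Qed.

Lemma dim_interval_sum (D : seq (\bar R * \bar R)) t :
  dim (pm_space (interval_sum F D) t) = count (alive t) D.
Proof.
elim: D => [|[b d] D IH]; first by rewrite /= dim_subvs dimv0.
by rewrite /= -IH -dim_interval_fiber -dim_subvs.
Qed.

Section LinearCombination.
Variable vT : vectType F.

(** Reads an element of the sum of the intervals at time [t] as coordinates and
    forms the linear combination of the attached vectors. The coordinate of an
    interval that is not alive is [0], so nothing needs to be filtered. *)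
Fixpoint bar_comb (l : seq (vT * (\bar R * \bar R))) (t : R) :
    pm_space (interval_sum F [seq x.2 | x <- l]) t -> vT :=
  match l with
  | [::] => fun _ => 0
  | x :: l' => fun y => (vsval y.1 : F) *: x.1 + bar_comb y.2
  end.

Lemma bar_comb_is_linear l t : linear (@bar_comb l t).
Proof.
elim: l => [|x l IH] k u v; first by rewrite /= scaler0 addr0.
rewrite /= IH scalerDr addrACA scalerDl scalerA; congr (_ + _).
Qed.

HB.instance Definition _ l t := GRing.isSemilinear.Build F _ vT _ (@bar_comb l t)
  (GRing.semilinear_linear (@bar_comb_is_linear l t)).

Lemma vsval_fiber b d t (y : subvs_of (interval_fiber F b d t)) :
  ~~ alive t (b, d) -> vsval y = 0.
Proof.
move=> al; suff fiber0 v : v \in interval_fiber F b d t -> v = 0.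
  exact/fiber0/subvsP.
by rewrite /interval_fiber; move: al; rewrite /alive /= => /negPf ->;
  rewrite memv0 => /eqP.
Qed.

Lemma bar_comb_alive l t x : x \in l -> alive t x.2 ->
  exists y, @bar_comb l t y = x.1.
Proof.
elim: l => [//|z l IH]; rewrite inE => /orP[/eqP <-|xl] al.
  exists (vsproj _ (1 : F^o), 0); rewrite /= linear0 addr0 vsprojK ?scale1r//.
  by rewrite /interval_fiber; move: al; rewrite /alive => ->; rewrite memvf.
have [y <-] := IH xl al; exists (0, y).
by rewrite /= scale0r add0r.
Qed.

(** The structure map of the sum of intervals only forgets the coordinates of the
    intervals that die in between, and their vectors lie in [B]. *)
Lemma bar_comb_map (B : {vspace vT}) l (s t : R) y : s <= t ->
  (forall x, x \in l -> (x.2.2 <= t%:E)%E -> x.1 \in B) ->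
  @bar_comb l t (pm_map (interval_sum F [seq x.2 | x <- l]) s t y) - bar_comb y \in B.
Proof.
move=> st; elim: l y => [|[e [b d]] l IH] /= y lB; first by rewrite subrr mem0v.
rewrite linfunE; last by move=> k [u1 u2] [v1 v2]; rewrite /= !linearP.
rewrite /= opprD addrACA rpredD //; last first.
  by apply: IH => x xl; apply: lB; rewrite inE xl orbT.
rewrite -scalerBl; set a := _ - _.
have [tp|] := boolP (alive t (b, d)); last first.
  have [dt _|] := leP d t%:E.
    by rewrite rpredZ //; apply: (lB (e, (b, d))) => //; rewrite inE eqxx.
  rewrite /alive /= => td; rewrite td andbT => bt.
  rewrite /a !vsval_fiber ?subrr ?scale0r ?mem0v //.
    by apply: contra bt => /andP[/= bs _]; apply: le_trans bs _; rewrite lee_fin.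
  by rewrite /alive /= negb_and bt.
suff -> : a = 0 by rewrite scale0r mem0v.
rewrite /a linfunE ?vsprojK ?subrr //; last by move=> k u v; rewrite !linearP.
by move: tp; rewrite /interval_fiber /alive /= => ->; rewrite memvf.
Qed.

Lemma bar_comb_in (Z : {vspace vT}) l t (y : pm_space (interval_sum F [seq x.2 | x <- l]) t) :
  (forall x, x \in l -> (x.2.1 <= t%:E)%E -> x.1 \in Z) -> bar_comb y \in Z.
Proof.
elim: l y => [|[e [b d]] l IH] /= y lZ; first exact: mem0v.
rewrite rpredD //; last by apply: IH => x xl; apply: lZ; rewrite inE xl orbT.
have [bt|bt] := leP b t%:E.
  by rewrite rpredZ //; apply: (lZ (e, (b, d))) => //; rewrite inE eqxx.
by rewrite vsval_fiber ?scale0r ?mem0v // /alive /= negb_and -ltNge bt.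
Qed.

Lemma span_alive_bar_comb l t :
  (<<[seq x.1 | x <- l & alive t x.2]>> <= limg (linfun (@bar_comb l t)))%VS.
Proof.
apply/span_subvP => e /mapP[x]; rewrite mem_filter => /andP[al xl] ->.
have [y <-] := bar_comb_alive xl al.
by apply/memv_imgP; exists y; rewrite ?memvf // lfunE.
Qed.

Variables (Z B : R -> {vspace vT}).
Hypothesis Zmono : forall s t, 0 <= s -> s <= t -> (Z s <= Z t)%VS.
Hypothesis Bmono : forall s t, 0 <= s -> s <= t -> (B s <= B t)%VS.

Definition quotient_module : persmod R F :=
  @Persmod R F (fun t => quotv (Z t) (B t))
    (fun s t => quotv_map (Z s) (B s) (Z t) (B t)).

(** A family of vectors with births and deaths decomposes the module of the
    quotients [Z t / B t] as soon as, at every time, the alive vectors generate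
    [Z t] modulo [B t] and are as many as the dimension of the quotient: taking
    linear combinations is then a surjection between spaces of the same
    dimension. *)
Lemma quotient_module_decomposition l :
  (forall x t, x \in l -> 0 <= t -> (x.2.1 <= t%:E)%E -> x.1 \in Z t) ->
  (forall x t, x \in l -> 0 <= t -> (x.2.2 <= t%:E)%E -> x.1 \in B t) ->
  (forall t, 0 <= t ->
    (Z t <= <<[seq x.1 | x <- l & alive t x.2]>> + B t)%VS /\
    (\dim (Z t) = count (fun x => alive t x.2) l + \dim (Z t :&: B t))%N) ->
  pm_iso quotient_module (interval_sum F [seq x.2 | x <- l]).
Proof.
move=> lZ lB lZB.
pose psi t : 'Hom(pm_space (interval_sum F [seq x.2 | x <- l]) t, quotv (Z t) (B t)) :=
  linfun (fun y => vsproj (class_mod (B t) @: Z t)%VS (class_mod (B t) (bar_comb y))).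
have psiE t y : 0 <= t -> vsval (psi t y) = class_mod (B t) (bar_comb y).
  move=> t0; rewrite linfunE; last by move=> k u v; rewrite !linearP.
  by rewrite vsprojK // memv_img // bar_comb_in // => x xl; apply: lZ.
have psi_sur t : 0 <= t -> limg (psi t) = fullv.
  move=> t0; apply/vspaceP => h; rewrite memvf; apply/memv_imgP.
  have /memv_imgP[z zZ hz] := subvsP h.
  have /memv_addP[w wl [b bB zwb]] := subvP (lZB t t0).1 z zZ.
  have /memv_imgP[y _ wy] := subvP (span_alive_bar_comb l t) w wl.
  exists y; rewrite ?memvf//; apply: val_inj; rewrite /= psiE // hz.
  by apply/eqP; rewrite -class_mod_eq zwb wy lfunE /= addrC addKr.
have psi_inj t : 0 <= t -> lker (psi t) == 0%VS.
  move=> t0; rewrite -dimv_eq0; have := limg_ker_dim (psi t) fullv.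
  rewrite psi_sur // capfv !dimvf dim_interval_sum dim_subvs count_map.
  have := dim_class_mod (Z t) (B t); rewrite (lZB t t0).2.
  rewrite (eq_count (a2 := fun x => alive t x.2)) //.
  by set c := count _ _; set k := \dim (lker _); set q := \dim (_ @: _); lia.
exists (fun t => (psi t)^-1%VF); split=> [t t0|s t s0 st x].
  exists (psi t); last exact: lker0_lfunK (psi_inj t t0).
  by move=> x; rewrite limg_lfunVK // psi_sur // memvf.
have t0 : 0 <= t by apply: le_trans st.
apply: (can_inj (lker0_lfunK (psi_inj t t0))).
rewrite limg_lfunVK ?psi_sur ?memvf//.
set y := (psi s)^-1%VF x.
have -> : x = psi s y by rewrite limg_lfunVK ?psi_sur ?memvf.
apply: val_inj; rewrite /= quotv_mapE ?psiE //; try by [apply: Zmono|apply: Bmono].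
rewrite class_mod_comp ?Bmono//; apply/esym/eqP; rewrite -class_mod_eq.
by apply: bar_comb_map => // z zl; apply: lB.
Qed.

End LinearCombination.

Lemma dim_limg_pair (U V U' V' : vectType F) (f : 'Hom(U, U')) (g : 'Hom(V, V')) :
  \dim (limg (linfun (fun x : U * V => (f x.1, g x.2))))
    = (\dim (limg f) + \dim (limg g))%N.
Proof.
have hE x : linfun (fun x : U * V => (f x.1, g x.2)) x = (f x.1, g x.2).
  by rewrite linfunE // => k [u1 u2] [v1 v2]; rewrite /= !linearP.
set h := linfun _ in hE *.
pose il : 'Hom(U', (U' * V')%type) := linfun (fun x => (x, 0)).
pose ir : 'Hom(V', (U' * V')%type) := linfun (fun x => (0, x)).
have ilE x : il x = (x, 0).
  by rewrite linfunE // => k u v; congr pair; rewrite /= ?scaler0 ?addr0.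
have irE x : ir x = (0, x).
  by rewrite linfunE // => k u v; congr pair; rewrite /= ?scaler0 ?addr0.
have il0 : lker il == 0%VS.
  by apply/lker0P => x y; rewrite !ilE => -[].
have ir0 : lker ir == 0%VS.
  by apply/lker0P => x y; rewrite !irE => -[].
have -> : limg h = (il @: limg f + ir @: limg g)%VS.
  apply/vspaceP => v; apply/memv_imgP/memv_addP => [[[x y] _ ->]|].
    exists (il (f x)); first by rewrite !memv_img ?memvf.
    exists (ir (g y)); first by rewrite !memv_img ?memvf.
    by rewrite hE ilE irE; congr pair; rewrite /= ?addr0 ?add0r.
  case=> _ /memv_imgP[_ /memv_imgP[x _ ->] ->].
  case=> _ /memv_imgP[_ /memv_imgP[y _ ->] ->] ->.
  exists (x, y); rewrite ?memvf//.
  by rewrite hE ilE irE; congr pair; rewrite /= ?addr0 ?add0r.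
have := dimv_sum_cap (il @: limg f)%VS (ir @: limg g)%VS.
rewrite (@limg_dim_eq _ _ _ il) ?(@limg_dim_eq _ _ _ ir) ?(eqP il0) ?(eqP ir0) ?capv0 // => <-.
suff -> : (il @: limg f :&: ir @: limg g = 0)%VS by rewrite dimv0 addn0.
apply/eqP; rewrite -subv0; apply/subvP => v; rewrite memv_cap.
case/andP => /memv_imgP[x _ ->] /memv_imgP[y _]; rewrite ilE irE => -[-> _].
by rewrite memv0.
Qed.

Lemma rank_interval_sum (D : seq (\bar R * \bar R)) (s t : R) : s <= t ->
  \dim (limg (pm_map (interval_sum F D) s t))
    = count (fun p => (p.1 <= s%:E)%E && (t%:E < p.2)%E) D.
Proof.
move=> st; elim: D => [|[b d] D IH] /=.
  apply/eqP; rewrite -leqn0 (leq_trans (dimvS (subvf _))) // dimvf dim_subvs.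
  by rewrite dimv0.
rewrite dim_limg_pair IH; congr addn.
set h := linfun _; have hE x : h x = vsproj (interval_fiber F b d t) (vsval x).
  by rewrite linfunE // => k u v; rewrite !linearP.
have [al|nal] := boolP (_ && _); last first.
  apply/eqP; rewrite dimv_eq0 -subv0; apply/subvP => v /memv_imgP[x _ ->].
  rewrite memv0 hE; apply/eqP; have [sal|sal] := boolP (alive s (b, d)); last first.
    by rewrite vsval_fiber ?linear0.
  apply: val_inj => /=; apply: vsval_fiber.
  apply: contra nal; rewrite /alive /= => /andP[_ ->].
  by move: sal; rewrite /alive /= => /andP[->].
have fs : interval_fiber F b d s = fullv.
  rewrite /interval_fiber; case/andP: al => -> td /=; rewrite ifT //.
  by apply: le_lt_trans td; rewrite lee_fin.
have ft : interval_fiber F b d t = fullv.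
  rewrite /interval_fiber; case/andP: al => bs -> /=; rewrite andbT ifT //.
  by apply: le_trans bs _; rewrite lee_fin.
rewrite limg_dim_eq; first by rewrite dimvf dim_subvs fs dimvf.
apply/eqP; rewrite -subv0; apply/subvP => v; rewrite memv_cap memvf memv_ker.
rewrite hE => /eqP /(congr1 vsval); rewrite vsprojK ?ft ?memvf // linear0 => v0.
by rewrite memv0; apply/eqP; apply: val_inj.
Qed.

Lemma rank_pm_iso (U V : persmod R F) (s t : R) :
  pm_iso U V -> 0 <= s -> s <= t ->
  \dim (limg (pm_map U s t)) = \dim (limg (pm_map V s t)).
Proof.
move=> [phi [phi_bij phi_nat]] s0 st; have t0 := le_trans s0 st.
have ker0 : lker (phi t) == 0%VS by apply/lker0P/bij_inj/phi_bij.
rewrite -(@limg_dim_eq _ _ _ (phi t)); last by rewrite (eqP ker0) capv0.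
have [psi _ psiK] := phi_bij s s0.
congr (\dim _); apply/vspaceP => v; apply/memv_imgP/memv_imgP.
  by case=> _ /memv_imgP[x _ ->] ->; exists (phi s x); rewrite ?memvf ?phi_nat.
case=> y _ ->; exists (pm_map U s t (psi y)); first by rewrite memv_img ?memvf.
by rewrite phi_nat // psiK.
Qed.

End IntervalSums.

(** * Invariance of homology ranks under relabelling of the vertices *)

Section HomologyRank.
Variables (F : fieldType) (X : finType) (lt : rel X).
Implicit Types K : {set {set X}}.

(** The rank of the map from the homology of [K] to that of [K'] when [K] is a
    subcomplex of [K']. It is defined for all sets of simplices, so that it is
    a function of purely finite data. *)
Definition homology_rank q K K' : nat :=
  (\dim (cycles F lt K q) - \dim (cycles F lt K q :&: boundaries F lt K' q))%N.

Lemma chains_mono q K K' : K \subset K' -> (chains F K q <= chains F K' q)%VS.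
Proof.
move=> KK'; apply: sub_span => c /mapP[s]; rewrite mem_enum inE => /andP[sK sq] ->.
by apply/mapP; exists s => //; rewrite mem_enum inE (fintype.subsetP KK').
Qed.

Lemma cycles_mono q K K' :
  K \subset K' -> (cycles F lt K q <= cycles F lt K' q)%VS.
Proof. by move=> KK'; apply: capvS => //; exact: chains_mono. Qed.

Lemma boundaries_mono q K K' :
  K \subset K' -> (boundaries F lt K q <= boundaries F lt K' q)%VS.
Proof. by move=> KK'; apply: limgS; exact: chains_mono. Qed.

Lemma homology_rank0 q K' : homology_rank q finset.set0 K' = 0%N.
Proof.
rewrite /homology_rank /cycles /chains (_ : [set s in finset.set0 | _] = finset.set0).
  by rewrite /image_mem enum_set0 /= span_nil cap0v dimv0.
by apply/finset.setP => s; rewrite !inE.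
Qed.

Lemma boundaryE (c : chain F X) :
  boundary F lt c = \sum_s c s *: boundary_simplex F lt s.
Proof.
rewrite linfunE // => k u v; rewrite scaler_sumr -big_split /=.
by apply: eq_bigr => s _; rewrite !ffunE scalerDl scalerA.
Qed.

End HomologyRank.

Section Relabelling.
Variables (F : fieldType) (X Y : finType) (ltX : rel X) (ltY : rel Y).
Variables (f : X -> Y).
Hypotheses (f_bij : bijective f) (f_lt : forall a b, ltY (f a) (f b) = ltX a b).

Let f_inj : injective f := bij_inj f_bij.

Lemma imset_bij : bijective (fun s : {set X} => f @: s).
Proof.
have [g fK gK] := f_bij; exists (fun u : {set Y} => g @: u) => s.
  by rewrite -imset_comp (eq_imset _ (g := id)) ?imset_id.
by rewrite -imset_comp (eq_imset _ (g := id)) ?imset_id.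
Qed.

Lemma preimset_eq (s : {set X}) (u : {set Y}) : (f @^-1: u == s) = (u == f @: s).
Proof.
have [g fK gK] := f_bij; apply/eqP/eqP => [<-|->].
  apply/finset.setP => y; apply/idP/imsetP => [yu|[x + ->]]; last by rewrite inE.
  by exists (g y); rewrite ?inE gK.
by apply/finset.setP => x; rewrite inE mem_imset.
Qed.

Definition relabel_fun (c : chain F X) : chain F Y :=
  [ffun u : {set Y} => c (f @^-1: u)].

Definition relabel : 'Hom(chain F X, chain F Y) := linfun relabel_fun.

Lemma relabelE c (u : {set Y}) : relabel c u = c (f @^-1: u).
Proof.
rewrite linfunE ?ffunE // => k a b; apply/ffunP => s.
by rewrite !ffunE.
Qed.

Lemma relabel_ker0 : lker relabel == 0%VS.
Proof.
apply/lker0P => c c' cc'; apply/ffunP => s.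
have /eqP <- : f @^-1: (f @: s) == s by rewrite preimset_eq.
by rewrite -!relabelE cc'.
Qed.

Lemma relabel_basis s : relabel (basis_chain F s) = basis_chain F (f @: s).
Proof.
by apply/ffunP => u; rewrite relabelE !ffunE preimset_eq.
Qed.

(** The relabelling preserves the order that orients the simplices, so even the
    signs agree. *)
Lemma relabel_boundary_simplex s :
  relabel (boundary_simplex F ltX s) = boundary_simplex F ltY (f @: s).
Proof.
rewrite /boundary_simplex linear_sum [RHS](reindex f) /=; last exact: onW_bij.
have fD v : f @: s :\ f v = f @: (s :\ v).
  apply/finset.setP => y; have [g fK gK] := f_bij.
  by rewrite -(gK y) !inE !mem_imset // !inE (inj_eq f_inj).
apply: eq_big => v; first by rewrite fD mem_imset // finset.imset_eq0.
move=> _; rewrite linearZ /= relabel_basis fD; congr (_ ^+ _ *: _).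
rewrite -(card_imset _ f_inj); congr #|pred_of_set _|.
apply/finset.setP => y; have [g fK gK] := f_bij.
by rewrite -(gK y) !inE !mem_imset // !inE f_lt.
Qed.

Lemma relabel_boundary c :
  relabel (boundary F ltX c) = boundary F ltY (relabel c).
Proof.
rewrite !boundaryE linear_sum [RHS](reindex (fun s : {set X} => f @: s)) /=.
  apply: eq_bigr => s _; rewrite linearZ /= relabel_boundary_simplex relabelE.
  by congr (c _ *: _); apply/esym/eqP; rewrite preimset_eq.
exact/onW_bij/imset_bij.
Qed.

Definition relabel_complex (K : {set {set X}}) : {set {set Y}} :=
  [set f @: (s : {set X}) | s in K].

Lemma relabel_chains q K :
  (relabel @: chains F K q = chains F (relabel_complex K) q)%VS.
Proof.
rewrite /chains limg_span; apply: eq_span => c; apply/mapP/mapP.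
  case=> b /mapP[s]; rewrite mem_enum inE => /andP[sK sq] -> ->.
  exists (f @: s); last exact: relabel_basis.
  by rewrite mem_enum inE imset_f //= card_imset.
case=> u; rewrite mem_enum inE => /andP[/imsetP[s sK ->] sq] ->.
exists (basis_chain F s); last by rewrite relabel_basis.
apply/mapP; exists s => //.
by rewrite mem_enum inE sK /= -(card_imset _ f_inj).
Qed.

Lemma relabel_cycles q K :
  (relabel @: cycles F ltX K q = cycles F ltY (relabel_complex K) q)%VS.
Proof.
rewrite /cycles lker0_img_cap ?relabel_ker0 // relabel_chains.
apply/vspaceP => c; rewrite !memv_cap; case: (boolP (c \in chains _ _ _)) => //=.
rewrite -relabel_chains => /memv_imgP[b _ ->].
rewrite -[in RHS](lker0_lfunK relabel_ker0 b) memv_ker -relabel_boundary.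
rewrite (lker0_lfunK relabel_ker0).
apply/memv_imgP/eqP => [[b' + /(lker0P relabel_ker0) ->]|b0].
  by rewrite memv_ker => /eqP ->; rewrite linear0.
exists b => //; rewrite memv_ker; apply/eqP; apply: (lker0P relabel_ker0).
by rewrite b0 linear0.
Qed.

Lemma relabel_boundaries q K :
  (relabel @: boundaries F ltX K q = boundaries F ltY (relabel_complex K) q)%VS.
Proof.
rewrite /boundaries -relabel_chains -!limg_comp; congr (_ @: _)%VS.
by apply/lfunP => c; rewrite !comp_lfunE relabel_boundary.
Qed.

Lemma relabel_homology_rank q K K' :
  homology_rank F ltX q K K'
    = homology_rank F ltY q (relabel_complex K) (relabel_complex K').
Proof.
rewrite /homology_rank -relabel_cycles -relabel_boundaries.
rewrite -lker0_img_cap ?relabel_ker0 //.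
by rewrite !limg_dim_eq // (eqP relabel_ker0) capv0.
Qed.

End Relabelling.

(** * Existence and ranks of the persistence diagram *)

Local Open Scope classical_set_scope.
Local Open Scope ring_scope.

Section CriticalValues.
Variable R : realType.

(** For finitely many values, being below [d] is the same as being at most [t] for
    a real [t] close to [d]; this turns strict inequalities into parameters of
    the filtration. *)
Lemma below_threshold (l : seq (\bar R)) (d : \bar R) : (0 < d)%E ->
  exists t : R, [/\ 0 <= t, (t%:E < d)%E &
    forall v, v \in l -> (v <= t%:E)%E = (v < d)%E].
Proof.
move=> d0; elim: l => [|v l [t [t0 td tl]]]; first by exists 0.
suff [s [st sd sv]] : exists s : R, [/\ t <= s, (s%:E < d)%E &
    ((v < d)%E -> (v <= s%:E)%E)].
  exists s; split => // [|w]; first exact: le_trans st.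
  rewrite inE => /orP[/eqP ->|wl].
    by apply/idP/idP => [ws|/sv//]; apply: le_lt_trans sd.
  apply/idP/idP => [ws|wd]; first exact: le_lt_trans sd.
  by apply: (@le_trans _ _ t%:E); rewrite ?lee_fin ?tl.
case: v => [r| |].
- have [rd|dr] := ltP r%:E d; last by exists t; split => //.
  exists (Num.max t r); split; first by rewrite le_max lexx.
    by rewrite EFin_max gt_max td.
  by rewrite lee_fin le_max lexx orbT.
- by exists t; split => //; rewrite ltNge leey.
- by exists t; split => //; rewrite leNye.
Qed.

(** Supplies the times at which a filtration is sampled in order to give two flags
    of finite length. *)
Lemma critical_values (l : seq (\bar R)) : exists (n : nat) (c : nat -> R),
  [/\ forall i, 0 <= c i,
      forall i j, (i < j <= n)%N -> c i < c j &
      forall t, 0 <= t -> exists m, [/\ (m <= n)%N, c m <= t,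
        (m < n)%N -> t < c m.+1 &
        forall v, v \in l -> (v <= t%:E)%E = (v <= (c m)%:E)%E]].
Proof.
pose s := sort <=%R (undup [seq r <- map fine l | 0 < r]).
have s_sorted : sorted <%R (0 :: s).
  rewrite /= path_min_sorted ?sort_lt_sorted ?undup_uniq //.
  by apply/allP => r; rewrite mem_sort mem_undup mem_filter => /andP[].
exists (size s), (nth 0 (0 :: s)).
have c0 i : 0 <= nth 0 (0 :: s) i.
  have [i_s|si] := ltnP i (size (0 :: s)); last by rewrite nth_default.
  have : nth 0 (0 :: s) i \in 0 :: s by rewrite mem_nth.
  rewrite inE => /orP[/eqP -> //|].
  by rewrite mem_sort mem_undup mem_filter => /andP[/ltW].
have cS i j : (i < j <= size s)%N -> nth 0 (0 :: s) i < nth 0 (0 :: s) j.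
  by case/andP=> ij js; rewrite lt_sorted_ltn_nth // inE /= ltnS ?js //; apply: leq_trans js; apply: ltnW.
split => // t t0.
pose P m := (m <= size s)%N && (nth 0 (0 :: s) m <= t).
have [|i /andP[] // |m /andP[ms mt] mmax] := @ex_maxnP P (size s).
  by exists 0%N; rewrite /P /=.
exists m; split => // [ms'|v vl].
  by rewrite ltNge; apply/negP => h; have := mmax m.+1; rewrite /P ms' h ltnn => /(_ isT).
apply/idP/idP => [vt|vm]; last by apply: le_trans vm _; rewrite lee_fin.
have [v0|v0] := leP v 0%E; first by apply: le_trans v0 _; rewrite lee_fin.
move: v0 vt vl; case: v => // r; rewrite lte_fin !lee_fin => r0 rt rl.
have rs : r \in 0 :: s.
  rewrite inE mem_sort mem_undup mem_filter r0 orbC /=.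
  by apply/orP; left; apply/mapP; exists r%:E.
have im : (index r (0%R :: s) <= m)%N.
  by apply: mmax; rewrite /P nth_index // rt andbT -ltnS index_mem.
rewrite -{1}(nth_index (0 : R) rs).
by move: im; rewrite leq_eqVlt => /orP[/eqP -> //|im]; apply/ltW/cS; rewrite im.
Qed.

End CriticalValues.

Section Diagrams.
Variables (R : realType) (N : nat) (F : fieldType).
Local Notation E := 'rV[R]_N.
Variables (kappa : {fset E} -> \bar R) (q : nat).

(** The simplices are sets of labels, not of points, so that complexes of
    different configurations with the same labels can be compared. When [v] is
    the inclusion of [Xi] and [P] means being at most [t], this is the complex
    K(Xi, t) of the filtration. *)
Definition subcomplex (I : finType) (v : I -> E) (P : pred (\bar R)) :
    {set {set I}} :=
  [set s : {set I} | (s != finset.set0) && P (kappa [fset v i | i in s]%fset)]%SET.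

Lemma subset_subcomplex (I : finType) (v : I -> E) (P Q : pred (\bar R)) :
  {subset P <= Q} -> subcomplex v P \subset subcomplex v Q.
Proof.
move=> PQ; apply/fintype.subsetP => s; rewrite !inE => /andP[-> /=].
exact: PQ.
Qed.

Lemma filtrationE (Xi : {fset E}) t :
  filtration kappa Xi t = subcomplex (val : Xi -> E) (fun y => (y <= t%:E)%E).
Proof. by []. Qed.

Lemma subset_filtration (Xi : {fset E}) (s t : R) : s <= t ->
  filtration kappa Xi s \subset filtration kappa Xi t.
Proof.
move=> st; rewrite !filtrationE; apply: subset_subcomplex => y.
by rewrite !unfold_in => ys; apply: le_trans ys _; rewrite lee_fin.
Qed.

Lemma Delta_seq (l : seq (\bar R * \bar R)) :
  (forall p, p \in l -> Delta_set p) ->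
  exists D : seq (Delta R), [seq (birth p, death p) | p <- D] = l.
Proof.
elim: l => [|p l IH] lD; first by exists [::].
have [|D <-] := IH; first by move=> x xl; apply: lD; rewrite inE xl orbT.
have pD : Delta_set p by apply: lD; rewrite inE eqxx.
by exists ((SigSub (mem_set pD) : Delta R) :: D); rewrite /= /birth /death -surjective_pairing.
Qed.

(** Interval decompositions exist because the cycles and the boundaries at the
    critical times form two flags in the space of chains. Hence the diagram is
    one of the decompositions, never the default value. *)
Lemma diagram_iso (Xi : {fset E}) :
  pm_iso (pers_homology F kappa q Xi)
    (interval_sum F [seq (birth p, death p) | p <- diagram F kappa q Xi]).
Proof.
pose good := [set D : seq (Delta R) | pm_iso (pers_homology F kappa q Xi)
  (interval_sum F [seq (birth p, death p) | p <- D])].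
suff : exists D, good D by exact: (@xgetPex _ [::] good).
have [n [c [c0 c_lt cP]]] :=
  critical_values [seq kappa [fsetval x in s]%fset | s : {set Xi}].
have KE t m : (forall v, v \in [seq kappa [fsetval x in s]%fset | s : {set Xi}] ->
     (v <= t%:E)%E = (v <= (c m)%:E)%E) ->
    filtration kappa Xi t = filtration kappa Xi (c m).
  move=> cm; apply/finset.setP => s; rewrite !inE cm //.
  by apply/mapP; exists s; rewrite ?mem_enum.
have c_le i j : (i <= j <= n)%N -> c i <= c j.
  by rewrite leq_eqVlt => /andP[/orP[/eqP -> //|ij] jn]; apply/ltW/c_lt; rewrite ij.
pose Zc i := cycles_at F kappa q Xi (c (minn i n)).
pose Bc i := boundaries_at F kappa q Xi (c (minn i n)).
have sub i j : (i <= j)%N -> filtration kappa Xi (c (minn i n))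
    \subset filtration kappa Xi (c (minn j n)).
  by move=> ij; apply/subset_filtration/c_le; lia.
have [||l [lP lm]] := @two_flags F _ n Zc Bc.
- by move=> i j ij; apply: cycles_mono; apply: sub.
- by move=> i j ij; apply: boundaries_mono; apply: sub.
(* Index [n.+1] of the second flag means that the class never dies. *)
pose dth j := if (j <= n)%N then (c j)%:E else +oo%E.
pose l' := [seq (x.1, ((c x.2.1)%:E, dth x.2.2)) | x <- l].
have [|D DE] := @Delta_seq [seq x.2 | x <- l'].
  move=> p /mapP[_ /mapP[x xl ->] ->]; have [ij iN _ jN _] := lP x xl.
  split => /=; first by rewrite lee_fin.
  by rewrite /dth; case: (leqP x.2.2 n) => jn; rewrite ?ltry // lte_fin c_lt // ij.
have c_alive t m i : (m <= n)%N -> c m <= t -> ((m < n)%N -> t < c m.+1) ->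
    (i <= n)%N -> (c i <= t) = (i <= m)%N.
  move=> mn mt tm iN; case: leqP => im.
    by apply: le_trans mt; apply: c_le; rewrite im.
  apply/negbTE; rewrite -ltNge; apply: lt_le_trans (tm _) (c_le _ _ _); lia.
have l'_alive t m i j : (m <= n)%N -> c m <= t -> ((m < n)%N -> t < c m.+1) ->
    (i <= n)%N -> (j <= n.+1)%N ->
    alive t ((c i)%:E, dth j) = (i <= m < j)%N.
  move=> mn mt tm iN jN; rewrite /alive /= lee_fin (c_alive t m) //; congr andb.
  rewrite /dth; case: (leqP j n) => jn; last by rewrite ltry; lia.
  by rewrite lte_fin ltNge (c_alive t m) // -ltnNge.
exists D; rewrite /good /= DE; apply: quotient_module_decomposition.
- by move=> s t _ st; apply/cycles_mono/subset_filtration.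
- by move=> s t _ st; apply/boundaries_mono/subset_filtration.
- move=> _ t /mapP[x xl ->] t0 /=; have [ij iN xZ jN _] := lP x xl.
  rewrite lee_fin => ct; apply: subvP xZ; apply/cycles_mono/subset_filtration.
  by rewrite (minn_idPl iN).
- move=> _ t /mapP[x xl ->] t0 /=; have [ij iN _ jN xB] := lP x xl.
  rewrite /dth; case: (leqP x.2.2 n) => jn //; rewrite lee_fin => ct.
  apply: subvP (xB jn); apply/boundaries_mono/subset_filtration.
  by rewrite (minn_idPl jn).
move=> t t0; have [m [mn mt tm vm]] := cP t t0.
have [Zl dimZ] := lm m mn.
have ZE : cycles_at F kappa q Xi t = Zc m.
  by rewrite /Zc /cycles_at (KE t m) // (minn_idPl mn).
have BE : boundaries_at F kappa q Xi t = Bc m.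
  by rewrite /Bc /boundaries_at (KE t m) // (minn_idPl mn).
have al x : x \in l -> alive t ((c x.2.1)%:E, dth x.2.2) = (x.2.1 <= m < x.2.2)%N.
  by move=> xl; have [ij iN _ jN _] := lP x xl; apply: l'_alive.
rewrite ZE BE /l' filter_map -map_comp count_map; split.
  by rewrite (eq_in_filter (a2 := fun x => (x.2.1 <= m < x.2.2)%N)).
by rewrite dimZ; congr addn; apply: eq_in_count => x xl /=; rewrite al.
Qed.

(** All interval decompositions of a module have the same ranks; this replaces
    their uniqueness. *)
Lemma diagram_rank (Xi : {fset E}) (s t : R) : 0 <= s -> s <= t ->
  count (fun p => (birth p <= s%:E)%E && (t%:E < death p)%E) (diagram F kappa q Xi)
  = homology_rank F (vertex_lt (Xi := Xi)) q
      (filtration kappa Xi s) (filtration kappa Xi t).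
Proof.
move=> s0 st; have := rank_interval_sum F
  [seq (birth p, death p) | p <- diagram F kappa q Xi] st.
rewrite count_map -(rank_pm_iso (diagram_iso Xi)) // => <-.
have := @dim_limg_quotv_map F _ (cycles_at F kappa q Xi s) (boundaries_at F kappa q Xi s)
  (cycles_at F kappa q Xi t) (boundaries_at F kappa q Xi t)
  (cycles_mono F _ q (subset_filtration Xi st))
  (boundaries_mono F _ q (subset_filtration Xi st)).
by rewrite /homology_rank -/(cycles_at _ _ _ _) -/(boundaries_at _ _ _ _) /= => <-; rewrite addnK.
Qed.

End Diagrams.

(** * Multiplicities of diagram points as combinations of ranks *)

Lemma count_balance (T : eqType) (l : seq T) (a1 a2 b1 b2 b3 : pred T) :
  (forall x, x \in l -> (a1 x + a2 x = b1 x + b2 x + b3 x)%N) ->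
  count b1 l = (count a1 l + count a2 l - (count b2 l + count b3 l))%N.
Proof.
move=> ab; suff : (count a1 l + count a2 l = count b1 l + count b2 l + count b3 l)%N by lia.
elim: l ab => [//|x l IH] ab /=.
have := ab x (mem_head _ _); have := IH (fun y yl => ab y (@mem_behead _ (x :: l) y yl)).
lia.
Qed.

Section Multiplicity.
Variables (R : realType) (N : nat) (F : fieldType).
Local Notation E := 'rV[R]_N.
Variables (kappa : {fset E} -> \bar R) (q : nat).
Hypothesis kappa_ge0 : forall s, s != fset0 -> (0 <= kappa s)%E.

(** Inclusion-exclusion for the quadrant counts of a diagram at the corner
    [(b, e)]: the ranks count the intervals born by (or before) [b] and dying at
    (or after) [e]. When [e] is infinite no interval dies after [e], while the
    rank into the complex of all simplices need not vanish, so that the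
    corresponding terms are left out. The value depends on the points only
    through their lexicographic order and the comparisons of the values of
    [kappa]. *)
Definition multiplicity (I : finType) (v : I -> E) (b d : \bar R) : nat :=
  let r (P Q : pred (\bar R)) :=
    homology_rank F (fun i j => lexlt (v i) (v j)) q
      (subcomplex kappa v P) (subcomplex kappa v Q) in
  (r (fun y => y <= b)%E (fun y => y < d)%E
   + (if (d < +oo)%E then r (fun y => y < b)%E (fun y => y <= d)%E else 0)
   - (r (fun y => y < b)%E (fun y => y < d)%E
   + (if (d < +oo)%E then r (fun y => y <= b)%E (fun y => y <= d)%E else 0)))%N.

Lemma eq_subcomplex (I : finType) (v : I -> E) (P Q : pred (\bar R)) :
  (forall s : {set I}, s != finset.set0 ->
     P (kappa [fset v i | i in s]%fset) = Q (kappa [fset v i | i in s]%fset)) ->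
  subcomplex kappa v P = subcomplex kappa v Q.
Proof.
by move=> PQ; apply/finset.setP => s; rewrite !inE; apply: andb_id2l; exact: PQ.
Qed.

Lemma imfset_set_neq0 (I : finType) (v : I -> E) (s : {set I}) :
  s != finset.set0 -> [fset v i | i in s]%fset != fset0.
Proof.
case/finset.set0Pn => i si; apply/fset0Pn; exists (v i).
by apply/imfsetP; exists i.
Qed.

(** Each of the four ranks counts the intervals of one quadrant at the corner
    [(b, d)], once the strict inequalities are replaced by nearby parameters;
    a point of the diagram at the corner itself is what the alternating sum
    retains. *)
Lemma xi_point (Xi : {fset E}) (p : Delta R) :
  xi F kappa q Xi [set p] = multiplicity (val : Xi -> E) (birth p) (death p).
Proof.
rewrite /xi; set D := diagram F kappa q Xi.
have bd (x : Delta R) : (0 <= birth x)%E /\ (birth x < death x)%E.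
  by have := set_valP x; rewrite /birth /death.
pose ks := [seq kappa [fset (val : Xi -> E) i | i in s]%fset | s : {set Xi}].
have inks (s : {set Xi}) : kappa [fset (val : Xi -> E) i | i in s]%fset \in ks.
  by apply/mapP; exists s; rewrite ?mem_enum.
have p_eq x : (x \in [set p]) = (birth x == birth p) && (death x == death p).
  apply/idP/andP => [/set_mem ->|[/eqP bx /eqP dx]]; first by rewrite !eqxx.
  apply/mem_set; apply: (@val_inj _ _ (set_type (@Delta_set R))); rewrite /= -[val]set_valE.
  by rewrite (surjective_pairing (set_val x)) (surjective_pairing (set_val p)); congr pair.
have [b0 bd_p] := bd p.
move: b0 bd_p p_eq; move: (birth p) (death p) => b d b0 bd_p p_eq.
case: b b0 bd_p p_eq => [b| |] b0 bd_p p_eq; [|by rewrite ltNge leey in bd_p|by []].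
(* The birth [b] is put in the list so that [b <= t] follows from [b < d]. *)
have [t [t0 td tl]] := below_threshold
  (b%:E :: [seq death x | x <- D] ++ ks) (le_lt_trans b0 bd_p).
have bt : b <= t by rewrite -lee_fin tl ?inE ?eqxx.
have {}b0 : 0 <= b by rewrite lee_fin in b0.
rewrite /multiplicity; set r := homology_rank _ _ _.
have Kd : subcomplex kappa (val : Xi -> E) (fun y => y < d)%E = filtration kappa Xi t.
  by rewrite filtrationE; apply: eq_subcomplex => s _; rewrite tl // inE mem_cat inks !orbT.
have td_D x : x \in D -> (t%:E < death x)%E = (d <= death x)%E.
  by move=> xD; rewrite !ltNge tl ?leNgt // inE mem_cat map_f ?orbT.
have r_le (u : R) : b <= u ->
    r (subcomplex kappa (val : Xi -> E) (fun y => y <= b%:E)%E) (filtration kappa Xi u)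
    = count (fun x => (birth x <= b%:E)%E && (u%:E < death x)%E) D.
  by move=> bu; rewrite diagram_rank.
have r_lt (u : R) : b <= u ->
    r (subcomplex kappa (val : Xi -> E) (fun y => y < b%:E)%E) (filtration kappa Xi u)
    = count (fun x => (birth x < b%:E)%E && (u%:E < death x)%E) D.
  (* There is no parameter below the birth 0, but then both counts vanish, since
       [kappa] is nonnegative. *)
  move=> bu; move: b0; rewrite le_eqVlt => /orP[/eqP b0|b0].
    rewrite -b0 (_ : subcomplex _ _ _ = finset.set0); last first.
      apply/finset.setP => s; rewrite !inE; apply/negbTE/negP => /andP[s0].
      by apply/negP; rewrite -leNgt; apply/kappa_ge0/imfset_set_neq0.
    rewrite /r homology_rank0; apply/esym/eqP; rewrite -leqn0 leqNgt -has_count.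
    by apply/hasPn => x _; rewrite ltNge (bd x).1.
  have [|s [s0 sb sl]] := @below_threshold _ ([seq birth x | x <- D] ++ ks) b%:E.
    by rewrite lte_fin.
  rewrite lte_fin in sb.
  have -> : subcomplex kappa (val : Xi -> E) (fun y => y < b%:E)%E = filtration kappa Xi s.
    by rewrite filtrationE; apply: eq_subcomplex => w _; rewrite sl // mem_cat inks !orbT.
  rewrite /r -diagram_rank //; last by rewrite (le_trans (ltW sb)).
  by apply: eq_in_count => x xD; rewrite sl // mem_cat map_f.
rewrite Kd r_le // r_lt //.
have -> : (if (d < +oo)%E then r (subcomplex kappa (val : Xi -> E) (fun y => y < b%:E)%E)
     (subcomplex kappa (val : Xi -> E) (fun y => y <= d)%E) else 0%N)
   = count (fun x => (birth x < b%:E)%E && (d < death x)%E) D.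
  case: ifP => [doo|doo].
    by case: d doo bd_p {p_eq td tl Kd td_D} => // d _ bd_p; rewrite r_lt // -lee_fin ltW.
  apply/esym/eqP; rewrite -leqn0 leqNgt -has_count; apply/hasPn => x _.
  by move: doo; rewrite lt_neqAle leey andbT => /negbFE/eqP ->; rewrite [(+oo < _)%E]ltNge leey andbF.
have -> : (if (d < +oo)%E then r (subcomplex kappa (val : Xi -> E) (fun y => y <= b%:E)%E)
     (subcomplex kappa (val : Xi -> E) (fun y => y <= d)%E) else 0%N)
   = count (fun x => (birth x <= b%:E)%E && (d < death x)%E) D.
  case: ifP => [doo|doo].
    by case: d doo bd_p {p_eq td tl Kd td_D} => // d _ bd_p; rewrite r_le // -lee_fin ltW.
  apply/esym/eqP; rewrite -leqn0 leqNgt -has_count; apply/hasPn => x _.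
  by move: doo; rewrite lt_neqAle leey andbT => /negbFE/eqP ->; rewrite [(+oo < _)%E]ltNge leey andbF.
apply: count_balance => x xD; rewrite p_eq td_D //.
by case: (ltgtP (birth x) b%:E); case: (ltgtP d (death x)).
Qed.

Lemma multiplicity_relabel (I : finType) (v : I -> E) (Xi : {fset E}) b d :
  injective v -> Xi = [fset v i | i in I]%fset ->
  multiplicity (val : Xi -> E) b d = multiplicity v b d.
Proof.
move=> v_inj XiE.
have vXi i : v i \in Xi by rewrite XiE; apply/imfsetP; exists i.
pose f i : Xi := [` vXi i]%fset.
have f_inj : injective f by move=> i j /(congr1 val); exact: v_inj.
have f_bij : bijective f.
  apply: inj_card_bij => //; rewrite -cardfE XiE card_imfset //=.
  by rewrite -cardE.
have KE P : subcomplex kappa (val : Xi -> E) P = relabel_complex f (subcomplex kappa v P).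
  have im (s : {set I}) :
      [fset val x | x in f @: s]%fset = [fset v i | i in s]%fset.
    apply/fsetP => y; apply/imfsetP/imfsetP => /= [[_ /imsetP[i si ->] ->]|[i si ->]].
      by exists i.
    by exists (f i) => //; apply: imset_f.
  have [g gK _] := imset_bij f_bij; have [g' _ g'K] := imset_bij f_bij.
  apply/finset.setP => u; rewrite -(g'K u) mem_imset; last exact: can_inj gK.
  by rewrite !inE im finset.imset_eq0.
have rE P Q : homology_rank F (fun i j : Xi => lexlt (val i) (val j)) q
      (subcomplex kappa (val : Xi -> E) P) (subcomplex kappa (val : Xi -> E) Q) =
    homology_rank F (fun i j => lexlt (v i) (v j)) q
      (subcomplex kappa v P) (subcomplex kappa v Q).
  by rewrite !KE; apply/esym/relabel_homology_rank.
by rewrite /multiplicity !rE.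
Qed.

Lemma xi_enum (I : finType) (v : I -> E) (p : Delta R) : injective v ->
  xi F kappa q [fset v i | i in I]%fset [set p]
    = multiplicity v (birth p) (death p).
Proof. by move=> v_inj; rewrite xi_point (multiplicity_relabel _ _ v_inj). Qed.

End Multiplicity.

(** * Markers relative to the observed configuration *)

Lemma leq_count_multiset (T : eqType) (s D : seq T) (P : pred T) :
  (forall x, count_mem x s <= count_mem x D)%N -> (count P s <= count P D)%N.
Proof.
elim: s D => [//|x s IH] D sD.
have xD : x \in D by rewrite -has_pred1 has_count; have := sD x; rewrite /= eqxx; lia.
rewrite (permP (perm_to_rem xD)) /= leq_add2l; apply: IH => y.
by have := sD y; rewrite (permP (perm_to_rem xD)) /= leq_add2l.
Qed.

Section RelativeMarkers.
Variables (R : realType) (N : nat) (F : fieldType).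
Local Notation E := 'rV[R]_N.
Variables (kappa : {fset E} -> \bar R) (q : nat).
Local Notation xi := (xi F kappa q).

Definition inside (L : set E) (Xi : {fset E}) : {fset E} :=
  [fset x in Xi | x \in L]%fset.

(** The quantification is over parts of the configuration itself, hence finite,
    whereas a marker must cope with every configuration outside of [L]. This is
    what makes the property a Borel one. *)
Definition relative_point_marker (L : set E) (Xi : {fset E}) (p : Delta R) :=
  forall Psi : {fset E}, (Psi `<=` outside L Xi)%fset ->
    (xi Psi [set p] < xi (Psi `|` inside L Xi)%fset [set p])%N.

Definition relative_marker (L : set E) (A : set (Delta R)) (Xi : {fset E}) :=
  exists2 p, A p & relative_point_marker L Xi p.

Lemma marker_relative (L : set E) A (Xi : {fset E}) :
  marker F kappa q L A (inside L Xi) -> relative_marker L A Xi.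
Proof.
move=> [p Ap [Xi0 _ Xip]]; exists p => // Psi PsiXi.
(* Markers are tested against nonempty configurations only; the empty one
   outside of [L] is obtained from the marker itself, which lies in [L]. *)
have [->|Psi0] := eqVneq Psi fset0.
  have := Xip _ Xi0; rewrite (_ : outside L (inside L Xi) = fset0) ?addn1 //.
  by apply/fsetP => x; rewrite !inE; case: (x \in L); rewrite ?andbF.
have := Xip _ Psi0; rewrite (_ : outside L Psi = Psi) ?addn1 //.
apply/fsetP => x; rewrite !inE; have := fsubsetP PsiXi x; rewrite !inE.
by case: (x \in Psi) => // /(_ isT) /andP[_ ->].
Qed.

(** Forgetting points outside of [L] only leaves fewer [Psi] to consider. *)
Lemma relative_markerS (L : set E) A (Xi Xi' : {fset E}) :
  (Xi' `<=` Xi)%fset -> (inside L Xi `<=` Xi')%fset ->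
  relative_marker L A Xi -> relative_marker L A Xi'.
Proof.
move=> sub subL [p Ap Xip]; exists p => // Psi PsiXi'.
have -> : inside L Xi' = inside L Xi.
  apply/fsetP => x; rewrite !inE; have := fsubsetP sub x; have := fsubsetP subL x.
  rewrite !inE; case: (x \in Xi'); case: (x \in Xi); case: (x \in L) => //=.
    by move=> _ /(_ isT).
  by move=> /(_ isT).
apply: Xip; apply: fsubset_trans PsiXi' _; apply/fsubsetP => x.
by rewrite !inE => /andP[/(fsubsetP sub) -> ->].
Qed.

(** Remove the sets [Lam j] one after the other: each removal lowers the
    multiplicity of [p] by at least one. *)
Lemma leq_relative_point_marker (K : eqType) (Lam : K -> set E) (Xi : {fset E})
    (p : Delta R) (js : seq K) :
  uniq js -> (forall i j x, Lam i x -> Lam j x -> i = j) ->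
  (forall j, j \in js -> relative_point_marker (Lam j) Xi p) ->
  (size js <= xi Xi [set p])%N.
Proof.
move=> js_uniq disj js_p.
pose rest s : {fset E} := [fset x in Xi | all (fun j => x \notin Lam j) s]%fset.
suff rest_le s : uniq s -> {subset s <= js} ->
    (size s + xi (rest s) [set p] <= xi Xi [set p])%N.
  by apply: leq_trans (rest_le js js_uniq _); rewrite ?leq_addr.
elim: s => [|j s IH] /=.
  move=> _ _; rewrite add0n (_ : rest [::] = Xi) //.
  by apply/fsetP => x; rewrite !inE andbT.
move=> /andP[js' s_uniq] sub.
apply: leq_trans (IH s_uniq _); last by move=> i si; apply: sub; rewrite inE si orbT.
have jp := js_p j (sub _ (mem_head _ _)) (rest (j :: s)).
have -> : rest s = (rest (j :: s) `|` inside (Lam j) Xi)%fset.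
  apply/fsetP => x; rewrite !inE /=; case: (x \in Xi) => //=.
  case: (boolP (x \in Lam j)) => /= xj; rewrite ?orbF //.
  apply/allP => i si; apply/negP => xi; move/set_mem : xi => xi.
  by move: xj => /set_mem /(disj _ _ _ xi) ij; rewrite -ij si in js'.
rewrite addSnnS leq_add2l; apply: jp; apply/fsubsetP => x; rewrite !inE /=.
by case/andP=> -> /andP[].
Qed.

(** Adding a marker for one point of the diagram may destroy other points, so the
    sets cannot simply be removed one after the other while counting in [A].
    The points [pt j] are instead collected as a multiset, which is contained in
    the diagram because this holds for the multiplicity of each single point. *)
Lemma leq_relative_marker (K : eqType) (Lam : K -> set E) (Xi : {fset E})
    (A : set (Delta R)) (js : seq K) :
  uniq js -> (forall i j x, Lam i x -> Lam j x -> i = j) ->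
  (forall j, j \in js -> relative_marker (Lam j) A Xi) ->
  (size js <= xi Xi A)%N.
Proof.
move=> js_uniq disj js_A.
have /choice[pt ptP] : forall j, exists p, j \in js ->
    A p /\ relative_point_marker (Lam j) Xi p.
  move=> j; have [/js_A [p Ap jp]|_] := boolP (j \in js); first by exists p.
  by exists point.
have -> : size js = count (fun p => p \in A) [seq pt j | j <- js].
  rewrite count_map -(count_predT js); apply: eq_in_count => j js_j /=.
  by apply/esym/mem_set; have [] := ptP j js_j.
apply: leq_count_multiset => p; rewrite count_map.
have -> : count_mem p (diagram F kappa q Xi) = xi Xi [set p].
  apply: eq_count => x /=; apply/eqP/idP => [->|/set_mem //]; exact/mem_set.
rewrite -size_filter; apply: leq_relative_point_marker disj _.
  exact: filter_uniq.
by move=> j; rewrite mem_filter => /andP[/eqP <- /ptP[]].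
Qed.

Section Translation.
Hypothesis kappa_ge0 : forall s, s != fset0 -> (0 <= kappa s)%E.
Hypothesis kappa_shift : forall (s : {fset E}) (x : E), s != fset0 ->
  kappa [fset (y + x)%R | y in s]%fset = kappa s.

Definition translate_config (z : E) (Xi : {fset E}) : {fset E} := [fset (x + z)%R | x in Xi]%fset.

Lemma mem_shift z Xi (x : E) : (x \in translate_config z Xi) = (x - z \in Xi).
Proof.
apply/imfsetP/idP => [[y yXi ->]|xXi]; first by rewrite addrK.
by exists (x - z); rewrite ?subrK.
Qed.

Lemma lexltD (x y z : E) : lexlt (x + z) (y + z) = lexlt x y.
Proof.
apply: eq_existsb => i; rewrite !mxE ltrD2r; congr andb.
by apply: eq_forallb => j; rewrite !mxE (inj_eq (addIr _)).
Qed.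

(** The multiplicities depend on the points only through the values of [kappa]
    and the lexicographic order, and both are invariant under translations. *)
Lemma xi_shift z Xi p : xi (translate_config z Xi) [set p] = xi Xi [set p].
Proof.
rewrite !xi_point // (multiplicity_relabel F kappa q (v := fun i : Xi => val i + z)).
- have KE P : subcomplex kappa (fun i : Xi => val i + z) P
      = subcomplex kappa (val : Xi -> E) P.
    apply/finset.setP => s; rewrite !inE; apply: andb_id2l => s0.
    rewrite -(kappa_shift z (s := [fset val i | i in s]%fset)) ?imfset_set_neq0 //.
    congr (P (kappa _)); apply/fsetP => y; apply/imfsetP/imfsetP => /=.
      by case=> i si ->; exists (val i) => //; apply/imfsetP; exists i.
    by case=> _ /imfsetP[/= i si ->] ->; exists i.
  rewrite /multiplicity !KE.
  by have -> : (fun i j : Xi => lexlt (val i + z) (val j + z)) =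
    (fun i j => lexlt (val i) (val j)) by do 2!apply/funext => ?; rewrite lexltD.
- by move=> i j /addIr /val_inj.
apply/fsetP => y; apply/imfsetP/imfsetP => /= -[].
  by move=> x xXi ->; exists [` xXi]%fset.
by move=> x _ ->; exists (val x); first exact: valP.
Qed.

Lemma relative_marker_shift z (L L' : set E) A Xi :
  (forall x, L' x <-> L (x - z)) ->
  relative_marker L A Xi -> relative_marker L' A (translate_config z Xi).
Proof.
move=> LL' [p Ap Xip]; exists p => // Psi PsiXi.
have LE x : (x \in L') = (x - z \in L).
  by apply/idP/idP => /set_mem /LL' xL; apply/mem_set.
have -> : (Psi `|` inside L' (translate_config z Xi))%fset
    = translate_config z (translate_config (- z) Psi `|` inside L Xi)%fset.
  by apply/fsetP => x; rewrite !(inE, mem_shift) LE opprK subrK.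
rewrite xi_shift -(xi_shift (- z) Psi); apply: Xip.
apply/fsubsetP => x; rewrite mem_shift opprK.
by move=> /(fsubsetP PsiXi); rewrite !(inE, mem_shift) LE addrK.
Qed.

End Translation.
End RelativeMarkers.

(** * Borel events for finite configurations *)

Section DiscreteMeasurable.
Context {d : measure_display} {T : measurableType d}.

Lemma measurable_exists (A : countType) (P : A -> T -> Prop) :
  (forall a, measurable [set x | P a x]) -> measurable [set x | exists a, P a x].
Proof.
move=> mP; rewrite (_ : [set x | _] = \bigcup_a [set x | P a x]).
  by apply: countable_bigcupT_measurable => //; exact: countableP.
by apply/seteqP; split=> [x [a Pax]|x [a _ Pax]]; exists a.
Qed.

Lemma measurable_neg (P : T -> Prop) :
  measurable [set x | P x] -> measurable [set x | ~ P x].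
Proof. exact: measurableC. Qed.

Lemma measurable_conj (P Q : T -> Prop) : measurable [set x | P x] ->
  measurable [set x | Q x] -> measurable [set x | P x /\ Q x].
Proof. exact: measurableI. Qed.

Lemma measurable_prop (P : Prop) : measurable [set _ : T | P].
Proof.
have [p|p] := pselect P.
  by rewrite (_ : [set _ | P] = setT) //; apply/seteqP; split.
by rewrite (_ : [set _ | P] = set0) //; apply/seteqP; split.
Qed.

Lemma measurable_implies (P Q : T -> Prop) : measurable [set x | P x] ->
  measurable [set x | Q x] -> measurable [set x | P x -> Q x].
Proof.
move=> mP mQ; rewrite (_ : [set x | _] = ~` [set x | P x] `|` [set x | Q x]).
  by apply: measurableU => //; exact: measurableC.
apply/seteqP; split=> x /=; last by case=> // nP /nP.
by have [p|np] := pselect (P x) => [/(_ p)|_]; [right|left].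
Qed.

Lemma measurable_forall (A : countType) (P : A -> T -> Prop) :
  (forall a, measurable [set x | P a x]) -> measurable [set x | forall a, P a x].
Proof.
move=> mP; rewrite (_ : [set x | _] = ~` [set x | exists a, ~ P a x]).
  by apply/measurableC/measurable_exists => a; exact: measurable_neg.
apply/seteqP; split=> x /= h; first by case=> a; apply.
by move=> a; apply: contrapT => Pa; apply: h; exists a.
Qed.

(** Measurability for functions with countably many values, in a form that is
    stable under composition with arbitrary functions. *)
Definition fiber_measurable (A : countType) (g : T -> A) :=
  forall a, measurable [set x | g x = a].

Lemma fiber_measurable_pred (A : countType) (g : T -> A) (Q : A -> Prop) :
  fiber_measurable g -> measurable [set x | Q (g x)].
Proof.
move=> mg; rewrite (_ : [set x | _] = [set x | exists a, g x = a /\ Q a]).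
  by apply: measurable_exists => a; apply: measurable_conj => //; exact: measurable_prop.
by apply/seteqP; split=> x /=; [exists (g x)|case=> a [->]].
Qed.

Lemma fiber_measurable_comp (A B : countType) (h : A -> B) (g : T -> A) :
  fiber_measurable g -> fiber_measurable (fun x => h (g x)).
Proof. by move=> mg b; apply: (fiber_measurable_pred (fun a => h a = b)). Qed.

Lemma fiber_measurable_pair (A B : countType) (g : T -> A) (h : T -> B) :
  fiber_measurable g -> fiber_measurable h ->
  fiber_measurable (fun x => (g x, h x)).
Proof.
move=> mg mh [a b]; rewrite (_ : [set x | _] = [set x | g x = a /\ h x = b]).
  exact: measurable_conj.
by apply/seteqP; split=> x /= [-> ->].
Qed.

Lemma fiber_measurable_comp2 (A B C : countType) (f : A -> B -> C) (g : T -> A) (h : T -> B) :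
  fiber_measurable g -> fiber_measurable h ->
  fiber_measurable (fun x => f (g x) (h x)).
Proof. by move=> mg mh; exact: (fiber_measurable_comp (fun p => f p.1 p.2) (fiber_measurable_pair mg mh)). Qed.

Lemma fiber_measurable_cst (A : countType) (a : A) : fiber_measurable (fun _ : T => a).
Proof. by move=> b; exact: measurable_prop. Qed.

Lemma fiber_measurable_bool (P : T -> bool) :
  measurable [set x | P x] -> fiber_measurable P.
Proof.
move=> mP b; case: b => //; rewrite (_ : [set x | _] = ~` [set x | P x]).
  exact: measurableC.
by apply/seteqP; split=> x /=; [move=> ->|move=> /negP/negbTE].
Qed.

Lemma fiber_measurable_set (A : finType) (g : T -> {set A}) :
  (forall a, measurable [set x | a \in g x]) -> fiber_measurable g.
Proof.
move=> mg s; rewrite (_ : [set x | _] = [set x | forall a, (a \in g x) = (a \in s)]).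
  apply: measurable_forall => a; apply: fiber_measurable_bool; exact: mg.
by apply/seteqP; split=> x /=; [move=> ->|move=> ?; apply/finset.setP].
Qed.

Lemma fiber_measurable_prod (I : Type) (r : seq I) (h : I -> T -> nat) :
  (forall i, fiber_measurable (h i)) ->
  fiber_measurable (fun x => \prod_(i <- r) h i x)%N.
Proof.
move=> mh; elim: r => [|i r IH].
  by under eq_fun do rewrite big_nil; exact: fiber_measurable_cst.
by under eq_fun do rewrite big_cons; exact: (fiber_measurable_comp2 muln).
Qed.

End DiscreteMeasurable.

Section Configurations.
Variables (R : realType) (N : nat).
Local Notation E := 'rV[R]_N.
Local Notation BE := (borel_space R N).

HB.instance Definition _ := isPointed.Build {fset E} fset0.

Definition config := g_sigma_algebraType [set C : set {fset E} |
  exists (A : set E) (n : nat), measurable (A : set BE) /\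
    C = [set Xi | #|` inside A Xi| = n]].

Lemma fiber_measurable_count (A : set E) : measurable (A : set BE) ->
  fiber_measurable (fun Xi : config => #|` inside A Xi|).
Proof. by move=> mA n; apply: sub_sigma_algebra; exists A, n. Qed.

Lemma in_inside (A : set E) (Xi : {fset E}) x :
  (x \in inside A Xi) = (x \in Xi) && (x \in A).
Proof. by rewrite /inside in_fset. Qed.

Lemma in_outside (A : set E) (Xi : {fset E}) x :
  (x \in outside A Xi) = (x \in Xi) && (x \notin A).
Proof. by rewrite /outside in_fset. Qed.

Lemma inside_setT (Xi : {fset E}) : inside setT Xi = Xi.
Proof. by apply/fsetP => x; rewrite in_inside in_setT andbT. Qed.

Section Tuples.
Variable k : nat.

Definition config_tuple (Xi : {fset E}) (f : {ffun 'I_k -> Xi}) : k.-tuple BE :=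
  [tuple val (f i) | i < k].

(** The number of ways to label points of [Xi] by ['I_k], with repetitions, such
    that the tuple of labelled points lies in [C]. Repetitions are allowed
    because the count is then multiplicative on rectangles. *)
Definition tuple_count (C : set (k.-tuple BE)) (Xi : {fset E}) : nat :=
  #|[pred f : {ffun 'I_k -> Xi} | config_tuple f \in C]|.

Lemma tuple_count_rectangle (A : 'I_k -> set E) (Xi : {fset E}) :
  tuple_count [set x | forall i, A i (tnth x i)] Xi
    = (\prod_(i < k) #|` inside (A i) Xi|)%N.
Proof.
pose B i : pred Xi := [pred x | val x \in A i].
transitivity #|family B|.
  apply: eq_card => f; rewrite [LHS]inE [RHS]inE; apply/idP/forallP => [/set_mem fA i|fA].
    by change (val (f i) \in A i); apply/mem_set; have := fA i; rewrite tnth_mktuple.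
  by apply/mem_set => i; rewrite tnth_mktuple; apply/set_mem; exact: fA i.
rewrite card_family foldrE big_image /=; apply: eq_bigr => i _.
rewrite cardE -(size_map val); apply: perm_size; apply: uniq_perm.
- by rewrite map_inj_uniq ?enum_uniq //; exact: val_inj.
- exact: fset_uniq.
move=> x; have <- : (x \in inside (A i) Xi) = (x \in enum_fset (inside (A i) Xi)) by [].
rewrite in_inside; apply/mapP/andP => [[y]|].
  rewrite mem_enum => yB ->; have yA : val y \in A i by exact: yB.
  by split; first exact: valP.
case=> xXi xA.
by exists [` xXi]%fset; rewrite ?mem_enum.
Qed.

Lemma tuple_countT (Xi : {fset E}) : tuple_count setT Xi = (#|` Xi| ^ k)%N.
Proof.
rewrite cardfE -[k in RHS]card_ord -card_ffun; apply: eq_card => f.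
by rewrite [LHS]inE; apply/mem_set.
Qed.

Lemma tuple_countD (A B : set (k.-tuple BE)) (Xi : {fset E}) : B `<=` A ->
  tuple_count (A `\` B) Xi = (tuple_count A Xi - tuple_count B Xi)%N.
Proof.
move=> BA; have := cardID [pred f : {ffun 'I_k -> Xi} | config_tuple f \in B]
  [pred f : {ffun 'I_k -> Xi} | config_tuple f \in A].
set b := #|_|; set c := #|_|; set a := #|_|.
have -> : tuple_count A Xi = a by [].
have -> : tuple_count B Xi = b.
  apply: eq_card => f; apply/idP/andP => [fB|[] //].
  by split => //; apply/mem_set/BA/set_mem; exact: fB.
have -> : tuple_count (A `\` B) Xi = c.
  apply: eq_card => f; apply/idP/andP => [/set_mem[fA fB]|[fB fA]].
    by split; [apply/negP => /set_mem|apply/mem_set].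
  by apply/mem_set; split; [exact: (set_mem fA)|move=> fB'; case/negP: fB; apply/mem_set].
lia.
Qed.

(** By Dynkin's theorem: the count is a product of numbers of points when [C] is a
    rectangle, and it is additive and continuous in [C]. *)
Lemma fiber_measurable_tuple_count (C : set (k.-tuple BE)) : measurable C ->
  fiber_measurable (tuple_count C : config -> nat).
Proof.
pose rects := [set C : set (k.-tuple BE) | exists2 A : 'I_k -> set E,
  (forall i, measurable (A i : set BE)) & C = [set x | forall i, A i (tnth x i)]].
suff sub : <<s rects >> `<=`
    [set C | fiber_measurable (tuple_count C : config -> nat)].
  move=> mC; apply: sub; apply: sub_sigma_algebra2 mC => D.
  rewrite -bigcup_seq => -[i _ [A mA <-]]; exists (fun j => if j == i then A else setT).
    by move=> j; case: ifP => _ //; exact: measurableT.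
  apply/seteqP; split=> x /=; first by case=> _ xA j; case: eqP => [->|].
  by move=> /(_ i); rewrite eqxx.
apply: lambda_system_subset => //.
- move=> _ _ [A mA ->] [B mB ->]; exists (fun i => A i `&` B i).
    by move=> i; apply: measurableI.
  by apply/seteqP; split=> x /= => [[xA xB] i|xAB]; [split|split=> i; have [] := xAB i].
- split => //.
  + have cT := @fiber_measurable_count setT (@measurableT _ BE).
    rewrite /= (_ : tuple_count setT = fun Xi => (#|` Xi| ^ k)%N); last first.
      by apply/funext => Xi; rewrite tuple_countT.
    apply: (fiber_measurable_comp (fun n => n ^ k)%N); move=> n; have := cT n.
    rewrite (_ : [set Xi | _] = [set Xi | #|` Xi| = n]) //.
    by apply/funext => Xi /=; rewrite inside_setT.
  + move=> A B BA mA mB; rewrite /= (_ : tuple_count _ = fun Xi => tuple_count A Xi - tuple_count B Xi)%N.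
      exact: (fiber_measurable_comp2 subn).
    by apply/funext => Xi; rewrite tuple_countD.
  + move=> D Dmono mD n.
    rewrite (_ : [set Xi | _] = [set Xi | exists j0, forall j, (j0 <= j)%N -> tuple_count (D j) Xi = n]).
      apply: measurable_exists => j0; apply: measurable_forall => j.
      by apply: measurable_implies; [exact: measurable_prop|exact: mD].
    have ev (Xi : {fset E}) : exists j0, forall j, (j0 <= j)%N ->
        tuple_count (D j) Xi = tuple_count (\bigcup_j D j) Xi.
      have /choice[t tP] (f : {ffun 'I_k -> Xi}) : exists j,
          (\bigcup_j D j) (config_tuple f) -> D j (config_tuple f).
        have [[j _ fj]|h] := pselect ((\bigcup_j D j) (config_tuple f)); first by exists j.
        by exists 0%N.
      (* There are finitely many labellings, so one index is good for all of them. *)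
      exists (\max_f t f)%N => j tj; apply: eq_card => f.
      apply/idP/idP => /set_mem fC; apply/mem_set; first by exists j.
      have /subsetPset := Dmono _ _ (leq_trans (leq_bigmax f) tj); apply; exact: tP.
    apply/seteqP; split=> Xi /= => [XiC|[j0 j0P]].
      by have [j0 j0P] := ev Xi; exists j0 => j /j0P ->.
    have [j1 j1P] := ev Xi.
    by rewrite -(j1P (maxn j0 j1)) ?leq_maxr // j0P ?leq_maxl.
- move=> _ [A mA ->] /=.
  rewrite (_ : tuple_count _ = fun Xi => \prod_(i < k) #|` inside (A i) Xi|)%N; last first.
    by apply/funext => Xi; rewrite tuple_count_rectangle.
  by apply: fiber_measurable_prod => i; exact: fiber_measurable_count.
Qed.

End Tuples.
(** The configurations of [k] points in [Q] are those of size [k] that admit a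
    labelling in the given Borel set of tuples, and having such a labelling is an
    event by [fiber_measurable_tuple_count]. *)
Lemma measurable_config (Q : set {fset E}) :
  (forall k, measurable [set x : k.-tuple BE |
     uniq (x : seq E) /\ Q [fset y : E in (x : seq E)]%fset]) ->
  measurable (Q : set config).
Proof.
move=> mQ; pose C k := [set x : k.-tuple BE |
  uniq (x : seq E) /\ Q [fset y : E in (x : seq E)]%fset].
rewrite (_ : Q = [set Xi | exists k, (tuple_count (C k) Xi, #|` inside setT Xi|)
    \in [pred p : nat * nat | (0 < p.1)%N && (p.2 == k)]]).
  apply: measurable_exists => k; apply: (fiber_measurable_pred (fun p => p \in _)).
  apply: fiber_measurable_pair; first exact: fiber_measurable_tuple_count.
  exact: (fiber_measurable_count (@measurableT _ BE)).
apply/seteqP; split=> Xi /=; rewrite inside_setT.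
  move=> QXi; exists #|` Xi|; rewrite inE /= eqxx andbT.
  have szXi i : (i < #|` Xi|)%N -> nth 0 (enum_fset Xi) i \in Xi by move=> ?; apply: mem_nth.
  pose f := [ffun i : 'I_#|` Xi| => [` szXi i (ltn_ord i)]%fset].
  apply/card_gt0P; exists f; apply/mem_set.
  have fE : config_tuple f = enum_fset Xi :> seq E.
    apply: (@eq_from_nth _ 0); first by rewrite size_tuple.
    move=> i; rewrite size_tuple => ik.
    by rewrite -[i]/(val (Ordinal ik)) -tnth_nth tnth_mktuple ffunE.
  rewrite /C /= fE fset_uniq; split=> //; rewrite (_ : [fset _ in _]%fset = Xi) //.
  by apply/fsetP => y; rewrite !inE.
move=> [k]; rewrite inE /= => /andP[/card_gt0P[f /set_mem[f_uniq Qf]] /eqP Xik].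
suff <- : [fset y : E in (config_tuple f : seq E)]%fset = Xi by [].
apply/eqP; rewrite eqEfcard; apply/andP; split.
  apply/fsubsetP => y; rewrite !inE => /tnthP[i ->]; rewrite tnth_mktuple.
  exact: valP.
by rewrite card_fseq undup_id // size_tuple Xik.
Qed.

End Configurations.

(** * Relative markers form a Borel event *)

Lemma continuous_borel (R : realType) (X : ptopologicalType) (f : X -> R) :
  continuous f -> measurable_fun [set: g_sigma_algebraType (@open X)] f.
Proof.
move=> /continuousP cf; apply: (measurability _ (RGenOpens.measurableE R)).
move=> _ [_ [a [b ->] <-]]; rewrite setTI; apply: sub_sigma_algebra.
exact/cf/interval_open.
Qed.

Section MultiplicityMeasurable.
Variables (R : realType) (N : nat) (F : fieldType).
Local Notation E := 'rV[R]_N.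
Variables (kappa : {fset E} -> \bar R) (q : nat).
Context {d : measure_display} {T : measurableType d} (I : finType) (v : T -> I -> E).
Hypothesis v_lt : forall i j, measurable [set x | lexlt (v x i) (v x j)].
Hypothesis v_kappa : forall s : {set I}, s != finset.set0 ->
  measurable_fun setT (fun x => kappa [fset v x i | i in s]%fset).

Lemma fiber_measurable_subcomplex (P : T -> pred (\bar R)) :
  (forall s : {set I}, s != finset.set0 ->
     measurable [set x | P x (kappa [fset v x i | i in s]%fset)]) ->
  fiber_measurable (fun x => subcomplex kappa (v x) (P x)).
Proof.
move=> mP; apply: fiber_measurable_set => s.
have [->|s0] := eqVneq s finset.set0.
  rewrite (_ : [set x | _] = set0) //; apply/seteqP; split=> x //=.
  by rewrite inE eqxx.
rewrite (_ : [set x | _] = [set x | P x (kappa [fset v x i | i in s]%fset)]).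
  exact: mP.
by apply/funext => x /=; rewrite inE s0.
Qed.

Lemma fiber_measurable_rank (P Q : T -> pred (\bar R)) :
  (forall s : {set I}, s != finset.set0 ->
     measurable [set x | P x (kappa [fset v x i | i in s]%fset)]) ->
  (forall s : {set I}, s != finset.set0 ->
     measurable [set x | Q x (kappa [fset v x i | i in s]%fset)]) ->
  fiber_measurable (fun x =>
    homology_rank F (fun i j => lexlt (v x i) (v x j)) q
      (subcomplex kappa (v x) (P x)) (subcomplex kappa (v x) (Q x))).
Proof.
move=> mP mQ; pose lts x := finset (fun ij : I * I => lexlt (v x ij.1) (v x ij.2)).
have mlts : fiber_measurable lts.
  apply: fiber_measurable_set => -[i j].
  by under eq_set do rewrite inE; exact: v_lt.
pose rk lt KK : nat := homology_rank F (fun i j => (i, j) \in (lt : {set I * I})) q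
  (KK : {set {set I}} * {set {set I}}).1 KK.2.
rewrite (_ : (fun x => _) = fun x => rk (lts x)
    (subcomplex kappa (v x) (P x), subcomplex kappa (v x) (Q x))).
  apply: fiber_measurable_comp2 => //.
  by apply: fiber_measurable_pair; apply: fiber_measurable_subcomplex.
apply/funext => x; rewrite /rk; congr homology_rank.
by do 2!apply/funext => ?; rewrite inE.
Qed.

Lemma fiber_measurable_multiplicity (b e : T -> \bar R) :
  measurable_fun setT b -> measurable_fun setT e ->
  fiber_measurable (fun x => multiplicity F kappa q (v x) (b x) (e x)).
Proof.
move=> mb me.
have mle (f g : T -> \bar R) : measurable_fun setT f -> measurable_fun setT g ->
    measurable [set x | (f x <= g x)%E].
  by move=> mf mg; have := measurable_lee measurableT mf mg; rewrite setTI.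
have mlt (f g : T -> \bar R) : measurable_fun setT f -> measurable_fun setT g ->
    measurable [set x | (f x < g x)%E].
  by move=> mf mg; have := measurable_lte measurableT mf mg; rewrite setTI.
have moo : fiber_measurable (fun x => (e x < +oo)%E).
  by apply: fiber_measurable_bool; apply: mlt => //; exact: measurable_cst.
rewrite /multiplicity.
apply: (fiber_measurable_comp2 subn).
  apply: (fiber_measurable_comp2 addn).
    by apply: fiber_measurable_rank => s s0; [apply: mle|apply: mlt] => //; exact: v_kappa.
  apply: (fiber_measurable_comp2 (fun (c : bool) n => if c then n else 0%N)) => //.
  by apply: fiber_measurable_rank => s s0; [apply: mlt|apply: mle] => //; exact: v_kappa.
apply: (fiber_measurable_comp2 addn).
  by apply: fiber_measurable_rank => s s0; apply: mlt => //; exact: v_kappa.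
apply: (fiber_measurable_comp2 (fun (c : bool) n => if c then n else 0%N)) => //.
by apply: fiber_measurable_rank => s s0; apply: mle => //; exact: v_kappa.
Qed.

End MultiplicityMeasurable.

Section TupleEvents.
Variables (R : realType) (N : nat) (F : fieldType).
Local Notation E := 'rV[R]_N.
Local Notation BE := (borel_space R N).
Variables (kappa : {fset E} -> \bar R) (q : nat).
Hypothesis kappa_ge0 : forall s, s != fset0 -> (0 <= kappa s)%E.
Hypothesis kappa_meas : fin_measurable kappa.

Lemma measurable_coord (i : 'I_N) :
  measurable_fun [set: BE] (fun x : BE => (x : E) ord0 i).
Proof.
apply: (@continuous_borel R E (fun x : E => x ord0 i)); exact: coord_continuous.
Qed.

Variable k : nat.
Implicit Types x : k.-tuple BE.

Lemma measurable_tuple_coord (i : 'I_k) (j : 'I_N) :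
  measurable_fun [set: k.-tuple BE] (fun x => (tnth x i : E) ord0 j).
Proof.
apply: (measurableT_comp (measurable_coord j)); exact: measurable_tnth.
Qed.

Lemma measurable_tuple_lexlt (i j : 'I_k) :
  measurable [set x : k.-tuple BE | lexlt (tnth x i : E) (tnth x j : E)].
Proof.
rewrite (_ : [set x | _] = [set x : k.-tuple BE | exists a : 'I_N,
    (tnth x i : E) ord0 a < (tnth x j : E) ord0 a /\
    forall b : 'I_N, (b < a)%N -> (tnth x i : E) ord0 b = (tnth x j : E) ord0 b]).
  apply: measurable_exists => a; apply: measurable_conj.
    have := measurable_fun_ltr (measurable_tuple_coord i a) (measurable_tuple_coord j a).
    by move=> /(_ measurableT [set true] I); rewrite setTI.
  apply: measurable_forall => b; apply: measurable_implies; first exact: measurable_prop.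
  have := measurable_fun_eqr (measurable_tuple_coord i b) (measurable_tuple_coord j b).
  move=> /(_ measurableT [set true] I); rewrite setTI.
  by congr measurable; apply/seteqP; split=> x /= /eqP.
apply/seteqP; split=> x /=.
  case/existsP => a /andP[ija /forallP eqb]; exists a; split => // b ba.
  by have := eqb b; rewrite ba => /eqP.
case=> a [ija eqb]; apply/existsP; exists a; rewrite ija /=.
by apply/forallP => b; apply/implyP => ba; apply/eqP/eqb.
Qed.

Definition face x (s : {set 'I_k}) : {fset E} :=
  [fset (tnth x i : E) | i in s]%fset.

(** The measurability of [kappa] is a condition on the set of all entries of a
    tuple. A face is such a set, once the labels outside of it are sent to one of
    its own labels. *)
Lemma measurable_face (s : {set 'I_k}) : s != finset.set0 ->
  measurable_fun [set: k.-tuple BE] (fun x => kappa (face x s)).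
Proof.
case/finset.set0Pn => i0 si0.
pose pad x : k.-tuple BE := [tuple tnth x (if i \in s then i else i0) | i < k].
have padE x : face x s = [fset y : E in (pad x : seq E)]%fset.
  apply/fsetP => y; rewrite inE; apply/imfsetP/tnthP => /= [[i si ->]|[i ->]].
    by exists i; rewrite tnth_mktuple si.
  by rewrite tnth_mktuple; case: ifP => [si|_]; [exists i|exists i0].
have mpad : measurable_fun [set: k.-tuple BE] pad.
  apply/measurable_fun_tnthP => i.
  rewrite (_ : _ \o _ = fun x => tnth x (if i \in s then i else i0)).
    exact: measurable_tnth.
  by apply/funext => x /=; rewrite tnth_mktuple.
under eq_fun do rewrite padE.
apply: (measurableT_comp (f := fun x : k.-tuple BE => kappa [fset y : E in (x : seq E)]%fset)) => //.
by case: (k) i0 {si0 padE mpad s pad} => [[]//|k' _]; exact: kappa_meas.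
Qed.

(** If [b] is not a value of [kappa] on a face, then being at most [b] and being
    below [b] define the same complex, and the alternating sum cancels; the same
    holds for [e]. *)
Lemma multiplicity_critical (I : finType) (v : I -> E) b e :
  (0 < multiplicity F kappa q v b e)%N ->
  (exists2 s : {set I}, s != finset.set0 & b = kappa [fset v i | i in s]%fset) /\
  (e = +oo%E \/
   exists2 s : {set I}, s != finset.set0 & e = kappa [fset v i | i in s]%fset).
Proof.
move=> m_gt0; split.
  apply: contrapT => bcrit; move: m_gt0; rewrite /multiplicity.
  rewrite (@eq_subcomplex _ _ kappa _ v (fun y => y <= b)%E (fun y => y < b)%E).
    by rewrite subnn.
  move=> s s0; rewrite le_eqVlt; case: eqP => // sb.
  by case: bcrit; exists s.
have [->|eoo] := eqVneq e +oo%E; [by left|right].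
apply: contrapT => ecrit; move: m_gt0; rewrite /multiplicity ltey eoo.
rewrite (@eq_subcomplex _ _ kappa _ v (fun y => y <= e)%E (fun y => y < e)%E).
  by rewrite addnC subnn.
move=> s s0; rewrite le_eqVlt; case: eqP => // sb.
by case: ecrit; exists s.
Qed.

Definition face_mult x (J : {set 'I_k}) (b e : \bar R) : nat :=
  multiplicity F kappa q (fun i : {i | i \in J} => (tnth x (val i) : E)) b e.

Lemma xi_face x (J : {set 'I_k}) (p : Delta R) : uniq (x : seq E) ->
  xi F kappa q (face x J) [set p] = face_mult x J (birth p) (death p).
Proof.
move=> x_uniq; rewrite /face_mult -xi_enum //; last first.
  by move=> i j /(tuple_uniqP _ x_uniq) /val_inj.
congr xi; apply/fsetP => y; apply/imfsetP/imfsetP => /= -[].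
  by move=> i iJ ->; exists (exist _ i iJ).
by move=> i _ ->; exists (val i); rewrite ?(valP i).
Qed.

Definition death_value x (o : option {set 'I_k}) : \bar R :=
  if o is Some s then kappa (face x s) else +oo%E.

(** The existential quantifier over the points of Delta can be restricted to the
    finitely many points whose coordinates are values of [kappa] on faces, by
    [multiplicity_critical]; the set [S] consists of the labels of the points in
    [L]. *)
Lemma relative_marker_faces (L : set E) (I1 I2 : set (\bar R)) x :
  uniq (x : seq E) ->
  relative_marker F kappa q L [set p | I1 (birth p) /\ I2 (death p)]
    [fset y : E in (x : seq E)]%fset <->
  exists (s : {set 'I_k}) (o : option {set 'I_k}),
    ((s != finset.set0) && (o != Some finset.set0)) /\
    [/\ (0 <= kappa (face x s))%E, (kappa (face x s) < death_value x o)%E,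
        I1 (kappa (face x s)), I2 (death_value x o) &
        forall J S : {set 'I_k}, [set i | (tnth x i : E) \in L]%SET = S ->
          (forall i, i \in J -> i \notin S) ->
          (face_mult x J (kappa (face x s)) (death_value x o)
           < face_mult x (J :|: S) (kappa (face x s)) (death_value x o))%N].
Proof.
move=> x_uniq; set Xi := [fset y in _]%fset.
have inXi i : (tnth x i : E) \in Xi by rewrite inE mem_tnth.
have XiP (y : E) : y \in Xi -> exists i, y = tnth x i by rewrite inE => /tnthP.
have face_out (J S : {set 'I_k}) : [set i | (tnth x i : E) \in L]%SET = S -> (forall i, i \in J -> i \notin S) ->
    (face x J `<=` outside L Xi)%fset.
  move=> <- JS; apply/fsubsetP => _ /imfsetP[i /= iJ ->].
  rewrite in_outside inXi /=; apply/negP => xiL.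
  by have := JS i iJ; rewrite inE xiL.
have face_in (J S : {set 'I_k}) : [set i | (tnth x i : E) \in L]%SET = S ->
    (face x J `|` inside L Xi)%fset = face x (J :|: S).
  move=> <-; apply/fsetP => y; rewrite in_fsetU in_inside; apply/orP/imfsetP => /=.
    case=> [/imfsetP[i /= iJ ->]|/andP[]]; first by exists i; rewrite ?inE ?iJ.
    by move=> /XiP[i ->] xiL; exists i; rewrite ?inE ?xiL ?orbT.
  case=> i; rewrite inE => /orP[iJ|]; first by move=> ->; left; apply/imfsetP; exists i.
  by rewrite inE => xiL ->; right; rewrite inXi xiL.
split=> [[p [I1p I2p] pm]|].
  pose S := [set i | (tnth x i : E) \in L]%SET.
  have mult_lt (J : {set 'I_k}) : (forall i, i \in J -> i \notin S) ->
      (face_mult x J (birth p) (death p) < face_mult x (J :|: S) (birth p) (death p))%N.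
    move=> JS; rewrite -!xi_face // -(face_in J S) //.
    by apply: pm; exact: (face_out J S).
  have disj0 i : i \in (finset.set0 : {set 'I_k}) -> i \notin S by rewrite finset.in_set0.
  have := leq_ltn_trans (leq0n _) (mult_lt _ disj0).
  move=> /multiplicity_critical[[s s0 bs] death_p].
  have face_val (w : {set {i | i \in finset.set0 :|: S}}) :
      [fset (tnth x (val i) : E) | i in w]%fset = face x [set val i | i in w]%SET.
    apply/fsetP => y; apply/imfsetP/imfsetP => /= -[].
      by move=> i iw ->; exists (val i); rewrite ?imset_f.
    by move=> _ /imsetP[i iw ->] ->; exists i.
  have [tau [tau0 dE]] : exists o, o != Some finset.set0 /\ death_value x o = death p.
    case: death_p => [->|[w w0 ->]]; first by exists None.
    exists (Some [set val i | i in w]%SET); rewrite /= face_val; split=> //.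
    by apply: contra w0 => /eqP[/eqP]; rewrite finset.imset_eq0.
  exists [set val i | i in s]%SET, tau; rewrite tau0 finset.imset_eq0 s0.
  rewrite -face_val -bs dE; split => //.
  have : Delta_set (set_val p) by apply: set_valP.
  by case=> b0 bd; split => // J _ <-; exact: mult_lt.
move=> [s [tau [_ [b0 bd I1b I2d mult_lt]]]].
have pD : Delta_set (kappa (face x s), death_value x tau) by [].
exists (SigSub (mem_set pD) : Delta R) => // Psi Psi_out.
pose J := [set i | (tnth x i : E) \in Psi]%SET.
pose S := [set i | (tnth x i : E) \in L]%SET.
have PsiE : Psi = face x J.
  apply/fsetP => y; apply/idP/imfsetP => /= [yPsi|[i + ->]]; last by rewrite inE.
  have := fsubsetP Psi_out y yPsi; rewrite in_outside => /andP[/XiP[i yi] _].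
  by exists i; rewrite // inE -yi.
rewrite PsiE (face_in J S) // !xi_face //; apply: mult_lt => // i; rewrite !inE.
by move=> /(fsubsetP Psi_out); rewrite in_outside => /andP[].
Qed.

Lemma measurable_relative_marker_tuple (L : set E) (I1 I2 : set (\bar R)) :
  measurable (L : set BE) -> measurable I1 -> measurable I2 ->
  measurable [set x : k.-tuple BE | uniq (x : seq E) /\
    relative_marker F kappa q L [set p | I1 (birth p) /\ I2 (death p)]
      [fset y : E in (x : seq E)]%fset].
Proof.
move=> mL mI1 mI2.
pose faces x (s : {set 'I_k}) (o : option {set 'I_k}) :=
    [/\ (0 <= kappa (face x s))%E, (kappa (face x s) < death_value x o)%E,
        I1 (kappa (face x s)), I2 (death_value x o) &
        forall J S : {set 'I_k}, [set i | (tnth x i : E) \in L]%SET = S ->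
          (forall i, i \in J -> i \notin S) ->
          (face_mult x J (kappa (face x s)) (death_value x o)
           < face_mult x (J :|: S) (kappa (face x s)) (death_value x o))%N].
rewrite (_ : [set x | _] = [set x : k.-tuple BE | uniq (x : seq E) /\
    exists s o, ((s != finset.set0) && (o != Some finset.set0)) /\ faces x s o]);
  last first.
  apply/seteqP; split=> x /= [x_uniq h]; split => //;
    by apply/(relative_marker_faces L I1 I2 x_uniq).
apply: measurable_conj.
  rewrite (_ : [set x | _] = [set x : k.-tuple BE | forall i j : 'I_k,
      (forall b : 'I_N, (tnth x i : E) ord0 b = (tnth x j : E) ord0 b) -> i = j]).
    apply: measurable_forall => i; apply: measurable_forall => j; apply: measurable_implies; last exact: measurable_prop.
    apply: measurable_forall => b.
    have := measurable_fun_eqr (measurable_tuple_coord i b) (measurable_tuple_coord j b).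
    move=> /(_ measurableT [set true] Logic.I); rewrite setTI.
    by congr measurable; apply/seteqP; split=> x /= /eqP.
  apply/seteqP; split=> x /=.
    by move=> /tuple_uniqP x_inj i j xij; apply/x_inj/rowP.
  by move=> x_inj; apply/tuple_uniqP => i j xij; apply: x_inj; rewrite xij.
apply: measurable_exists => s; apply: measurable_exists => o.
have [/andP[s0 o0]|so] := boolP ((s != finset.set0) && (o != Some finset.set0)); last first.
  by rewrite (_ : [set x | _] = set0) //; apply/seteqP; split=> x //= [].
have mb : measurable_fun setT (fun x : k.-tuple BE => kappa (face x s)).
  exact: measurable_face.
have me : measurable_fun setT (fun x : k.-tuple BE => death_value x o).
  by case: o o0 => [w w0|_]; [apply: measurable_face|exact: measurable_cst].
rewrite (_ : [set x | _] = [set x : k.-tuple BE |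
  (0 <= kappa (face x s))%E /\ ((kappa (face x s) < death_value x o)%E /\
  (I1 (kappa (face x s)) /\ (I2 (death_value x o) /\
   forall J S : {set 'I_k}, [set i | (tnth x i : E) \in L]%SET = S ->
          (forall i, i \in J -> i \notin S) ->
          (face_mult x J (kappa (face x s)) (death_value x o)
           < face_mult x (J :|: S) (kappa (face x s)) (death_value x o))%N)))]); last first.
  apply/seteqP; split=> x /=; first by move=> [_ [? ? ? ? ?]].
  by move=> [? [? [? [? ?]]]]; split.
apply: measurable_conj.
  by have := measurable_lee measurableT (measurable_cst 0%E) mb; rewrite setTI.
apply: measurable_conj; first by have := measurable_lte measurableT mb me; rewrite setTI.
apply: measurable_conj; first by have := mb measurableT _ mI1; rewrite setTI.
apply: measurable_conj; first by have := me measurableT _ mI2; rewrite setTI.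
apply: measurable_forall => J; apply: measurable_forall => S; apply: measurable_implies.
  suff : fiber_measurable (fun x : k.-tuple BE => [set i | (tnth x i : E) \in L]%SET).
    exact.
  apply: fiber_measurable_set => i; rewrite (_ : [set x | _] = (fun x : k.-tuple BE => tnth x i) @^-1` L).
    by rewrite -[X in measurable X]setTI; apply: measurable_tnth.
  by apply/seteqP; split=> x /=; rewrite inE => xL; [exact: set_mem|exact: mem_set].
apply: measurable_implies; first exact: measurable_prop.
have mmult (K : {set 'I_k}) : fiber_measurable (fun x : k.-tuple BE =>
    face_mult x K (kappa (face x s)) (death_value x o)).
  apply: fiber_measurable_multiplicity => //; first by move=> i j; exact: measurable_tuple_lexlt.
  move=> w w0.
  rewrite (_ : (fun x => _) = fun x : k.-tuple BE => kappa (face x [set val i | i in w]%SET)).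
    by apply: measurable_face; rewrite finset.imset_eq0.
  apply/funext => x; congr kappa; apply/fsetP => y; apply/imfsetP/imfsetP => /= -[].
    by move=> i iw ->; exists (val i); rewrite ?imset_f.
  by move=> _ /imsetP[i iw ->] ->; exists i.
exact: (fiber_measurable_pred (fun p : nat * nat => (p.1 < p.2)%N) (fiber_measurable_pair (mmult J) (mmult (J :|: S)))).
Qed.

End TupleEvents.

Lemma measurable_relative_marker (R : realType) (N : nat) (F : fieldType)
    (kappa : {fset 'rV[R]_N} -> \bar R) (q : nat)
    (L : set 'rV[R]_N) (I1 I2 : set (\bar R)) :
  (forall s, s != fset0 -> (0 <= kappa s)%E) -> fin_measurable kappa ->
  measurable (L : set (borel_space R N)) -> measurable I1 -> measurable I2 ->
  measurable (relative_marker F kappa q L [set p | I1 (birth p) /\ I2 (death p)]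
    : set (config R N)).
Proof.
move=> kappa_ge0 kappa_meas mL mI1 mI2; apply: measurable_config => k.
exact: measurable_relative_marker_tuple.
Qed.

(** * Integer-valued measures are sums of unit masses *)

Section IntegerMeasures.
Variables (R : realType) (N : nat).
Local Notation E := 'rV[R]_N.
Local Notation BE := (borel_space R N).

Lemma borel_open (U : set E) : open U -> measurable (U : set BE).
Proof. exact: sub_sigma_algebra. Qed.

Lemma borel_set1 (x : E) : measurable ([set x] : set BE).
Proof.
rewrite -[X in measurable X](@setCK E); apply: measurableC; apply: borel_open.
rewrite openC; exact: (accessible_closed_set1 (hausdorff_accessible (@norm_hausdorff R E))).
Qed.

Lemma measurable_translate (z : E) (A : set E) : measurable (A : set BE) ->
  measurable ([set y | A (y + z)] : set BE).
Proof.
suff : measurable_fun [set: BE] (fun y : BE => (y : E) + z : BE).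
  by move=> mf mA; rewrite -[X in measurable X]setTI; exact: mf.
apply: (measurability _ (erefl : @measurable _ BE = <<s @open E >>)).
move=> _ [U oU <-]; rewrite setTI; apply: borel_open.
have : continuous (fun y : E => y + z).
  by move=> y; apply: continuousD => //; exact: cst_continuous.
by move/continuousP; exact.
Qed.

Lemma bounded_setP (A : set E) :
  bounded_set A <-> exists M : R, forall x, A x -> `|x| <= M.
Proof.
split=> [[M [_ h]]|[M AM]].
  by exists (M + 1); apply: h; rewrite ltrDl.
exists M; split; first exact: num_real.
by move=> y My x /AM; move/le_trans; apply; exact: ltW.
Qed.

Lemma bounded_subset (A B : set E) : A `<=` B -> bounded_set B -> bounded_set A.
Proof. by move=> AB /bounded_setP[M BM]; apply/bounded_setP; exists M => x /AB /BM. Qed.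

Lemma bounded_translate (z : E) (A : set E) : bounded_set A ->
  bounded_set [set y | A (y + z)].
Proof.
move=> /bounded_setP[M AM]; apply/bounded_setP; exists (M + `|z|) => y /AM yz.
by rewrite -[y](addrK z) (le_trans (ler_normB _ _)) // lerD2r.
Qed.

Definition atoms_in (m : set E -> \bar R) (V : set E) : {fset E} :=
  fset_set [set x | V x /\ (0 < m [set x])%E].

(** On [V], the set function [m] behaves as the counting measure of a finite set. *)
Definition counts_atoms (m : set E -> \bar R) (V : set E) : Prop :=
  forall A : set E, measurable (A : set BE) ->
    m (V `&` A) = (#|` inside A (atoms_in m V)|)%:R%:E.

Variable mu : {measure set BE -> \bar R}.
Hypothesis mu_int : forall A : set E, measurable (A : set BE) -> bounded_set A ->
  exists n : nat, mu A = n%:R%:E.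

Lemma mu_int_ge1 (A : set E) : measurable (A : set BE) -> bounded_set A ->
  mu A != 0%E -> (1 <= mu A)%E.
Proof.
move=> mA bA; have [n ->] := mu_int mA bA.
by case: n => [|n]; rewrite ?eqxx // lee_fin ler1n.
Qed.

(** If every point of a compact ball around [A] had a neighbourhood that meets [A]
    in measure zero, finitely many of them would cover [A]. So there is a point
    all of whose neighbourhoods meet [A] in positive measure, hence in measure at
    least one, and this bound passes to their intersection. *)
Lemma exists_atom (A : set E) : measurable (A : set BE) -> bounded_set A ->
  mu A != 0%E -> exists2 x, A x & (1 <= mu [set x])%E.
Proof.
move=> mA bA muA.
(* It suffices to find a point all of whose neighbourhoods meet [A] in positive
   measure. *)
suff [x xP] : exists x : E, forall U : set E, open U -> U x -> mu (A `&` U) != 0%E.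
  have mU n : measurable ((A `&` ball x n.+1%:R^-1) : set BE).
    by apply: measurableI => //; apply: borel_open; exact: ball_open.
  have U_ge1 n : (1 <= mu (A `&` ball x n.+1%:R^-1))%E.
    apply: mu_int_ge1 => //; first by apply: bounded_subset bA; exact: subIsetl.
    by apply: xP; [exact: ball_open|exact: ballxx].
  have capE : \bigcap_n (A `&` ball x n.+1%:R^-1) = A `&` [set x].
    apply/seteqP; split=> y.
      move=> h; split; first by have [] := h 0%N Logic.I.
      apply/esym/eqP; rewrite -subr_eq0 -normr_eq0; apply/negPn/negP => xy.
      have xy0 : 0 < `|x - y| by rewrite lt_def xy normr_ge0.
      have [n] : exists n : nat, n.+1%:R^-1 < `|x - y|.
        by near \oo => n; exists n; near: n; exact: near_infty_natSinv_lt (PosNum xy0).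
      by have [_] := h n Logic.I; rewrite -ball_normE /= => /lt_trans/[apply]; rewrite ltxx.
    by move=> [Ay yx] n _; split=> //; rewrite yx; apply: ballxx.
  have mAx : measurable ((A `&` [set x]) : set BE).
    by apply: measurableI => //; exact: borel_set1.
  have muAx : (1 <= mu (A `&` [set x]))%E.
    rewrite -capE -(cvg_lim _ (nonincreasing_cvg_mu _ mU _ _)) //; last first.
    - apply/nonincreasing_seqP => n; apply/subsetPset; apply: setIS.
      by apply: le_ball; rewrite lef_pV2 ?posrE // ler_nat.
    - by rewrite capE.
    - have [k ->] := mu_int (mU 0%N) (bounded_subset (@subIsetl _ _ _) bA).
      by rewrite ltry.
    apply: lime_ge; last by near=> n; exact: U_ge1.
    apply: ereal_nonincreasing_is_cvgn.
    apply/nonincreasing_seqP => n; apply: le_measure; rewrite ?inE //.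
    apply: setIS; apply: le_ball; rewrite lef_pV2 ?posrE // ler_nat.
    exact: leqnSn.
  exists x; last by apply: le_trans muAx _; apply: le_measure;
    rewrite ?inE //; exact: borel_set1.
  apply: contrapT => Ax; move: muAx; rewrite (_ : A `&` _ = set0).
    by rewrite measure0 lee_fin ler10.
  by apply/seteqP; split=> // y [Ay yx]; apply: Ax; rewrite -yx.
have [M AM] := (bounded_setP A).1 bA.
pose K := [set x : E | `|x| <= M].
have cK : compact K.
  apply: bounded_closed_compact; first by apply/bounded_setP; exists M.
  have : continuous (fun x : E => `|x|) by move=> x; exact: norm_continuous.
  by move=> /continuous_closedP /(_ _ (@closed_le R M)).
apply: contrapT => noatom; move/eqP: muA; apply.
have /choice[U UP] (x : E) : exists U : set E, [/\ open U, U x & mu (A `&` U) = 0%E].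
  apply: contrapT => nU; apply: noatom; exists x => U oU Ux; apply/eqP => U0.
  by apply: nU; exists U.
have := cK; rewrite compact_cover => /(_ _ setT U) [].
- by move=> x _; have [] := UP x.
- by move=> x _; exists x => //; have [] := UP x.
move=> D _ KD; apply/eqP; rewrite eq_le measure_ge0 andbT.
have AD : A `<=` \bigcup_(x in [set` D]) (A `&` U x).
  by move=> x Ax; have [y Dy Uy] := KD x (AM x Ax); exists y.
have := @content_sub_fsum _ _ _ mu _ _ _ _ (finite_fset D) _ mA AD.
rewrite fsbig1; last by move=> x _ /=; have [_ _ ->] := UP x.
apply => x _; apply: measurableI => //; apply: borel_open.
by have [] := UP x.
Unshelve. all: by end_near.
Qed.

Lemma atom_ge1 (x : E) : (0 < mu [set x])%E -> (1 <= mu [set x])%E.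
Proof.
move=> x0; apply: mu_int_ge1; [exact: borel_set1| |by rewrite gt_eqF].
by apply/bounded_setP; exists `|x| => y ->.
Qed.

Lemma fset_bigcup (B : {fset E}) : [set` B] = \bigcup_(x in [set` B]) [set x].
Proof. by rewrite (bigcup_imset1 [set` B] id) image_id. Qed.

Lemma measurable_fset (B : {fset E}) : measurable ([set` B] : set BE).
Proof.
rewrite fset_bigcup; apply: fin_bigcup_measurable => [|x _].
  exact: finite_fset.
exact: borel_set1.
Qed.

Lemma measure_fset (B : {fset E}) :
  mu [set` B] = (\sum_(x <- enum_fset B) mu [set x])%E.
Proof.
rewrite [in LHS]fset_bigcup (@measure_fin_bigcup _ _ _ mu _ _ (fun x : E => [set x])).
- by rewrite fsbig_finite /=; [rewrite set_fsetK|exact: finite_fset].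
- exact: finite_fset.
- by move=> x y _ _ [z [-> ->]].
- by move=> x _; exact: borel_set1.
Qed.

Lemma sume_1 (B : {fset E}) :
  (\sum_(x <- enum_fset B) 1)%E = (#|` B|)%:R%:E :> \bar R.
Proof.
by rewrite sumEFin big_const_seq count_predT iter_addr addr0.
Qed.

Lemma finite_atoms (V : set E) : measurable (V : set BE) -> bounded_set V ->
  finite_set [set x | V x /\ (0 < mu [set x])%E].
Proof.
move=> mV bV; apply: contrapT => /infinite_set_fset inf.
have [n Vn] := mu_int mV bV.
have [B BV Bn] := inf n.+1.
have : (mu [set` B] <= mu V)%E.
  by apply: le_measure; rewrite ?inE //; [exact: measurable_fset|move=> x /BV[]].
apply/negP; rewrite -ltNge Vn measure_fset.
apply: (@lt_le_trans _ _ (\sum_(x <- enum_fset B) 1)%E).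
  by rewrite sume_1 lte_fin ltr_nat.
rewrite !big_seq; apply: lee_sum => x xB; apply: atom_ge1.
by have [] := BV x xB.
Qed.

(** What remains of the measure after removing its atoms is integer-valued and
    has no atom, hence vanishes. *)
Lemma counts_atoms_simple (V : set E) :
  (forall x, (mu [set x] <= 1)%E) -> measurable (V : set BE) -> bounded_set V ->
  counts_atoms mu V.
Proof.
move=> mu1 mV bV A mA; set B := inside A (atoms_in mu V).
have inB x : x \in B -> [/\ V x, A x & (0 < mu [set x])%E].
  rewrite in_inside => /andP[+ /set_mem Ax].
  by rewrite in_fset_set; [move=> /set_mem[]|exact: finite_atoms].
have mVA : measurable ((V `&` A) : set BE) by apply: measurableI.
have mB := measurable_fset B.
have BVA : [set` B] `<=` V `&` A by move=> x /inB[].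
rewrite -(setDUK BVA) measureU //; last 2 first.
- exact: measurableD.
- by rewrite setDE setIC -setIA setICl setI0.
transitivity (mu [set` B] + mu ((V `&` A) `\` [set` B]))%E => //.
have -> : mu [set` B] = (#|` B|)%:R%:E.
  rewrite measure_fset -sume_1 !big_seq; apply: eq_bigr => x /inB[_ _ x0].
  by apply/eqP; rewrite eq_le mu1 atom_ge1.
suff -> : mu ((V `&` A) `\` [set` B]) = 0%E by rewrite adde0.
apply/eqP; apply: contrapT => /negP rest0.
have [||x [[Vx Ax] nBx] x1] := exists_atom _ _ rest0.
- exact: measurableD.
- by apply: bounded_subset bV => x [[]].
apply: nBx; rewrite /= in_inside; apply/andP; split; last exact/mem_set.
rewrite in_fset_set; last exact: finite_atoms.
by apply/mem_set; split => //; apply: lt_le_trans x1; rewrite lte_fin.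
Qed.

End IntegerMeasures.

(** * Configuration events as events of the law of the process *)

Section LawEvents.
Variables (R : realType) (N : nat).
Local Notation E := 'rV[R]_N.
Local Notation BE := (borel_space R N).

(** The law of a process is only known on the events generated by the masses of
    Borel sets. A Borel event for the configuration in [W] is the trace of such
    an event on the set functions that count their atoms in [W]. *)
Lemma law_event_config (W : set E) (Q : set {fset E}) :
  measurable (W : set BE) -> measurable (Q : set (config R N)) ->
  exists2 H : set (set E -> \bar R), law_events H &
    forall m, counts_atoms m W -> (H m <-> Q (atoms_in m W)).
Proof.
move=> mW; pose good := [set Q : set {fset E} | exists2 H : set (set E -> \bar R),
  law_events H & forall m, counts_atoms m W -> (H m <-> Q (atoms_in m W))].
suff : @measurable _ (config R N) `<=` good by apply.
apply: smallest_sub.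
  have [law0 lawC lawU] := @smallest_sigma_algebra _ setT
    [set C | exists (A : set E) (B : set (\bar R)),
         [/\ measurable (A : set BE), measurable B &
             C = (fun m : set E -> \bar R => m A) @^-1` B]].
  split; first by exists set0.
    move=> A [H lawH HA]; exists (setT `\` H); first exact: lawC.
    move=> m mW'; have [HA1 HA2] := HA m mW'.
    by split=> -[_ nH]; split => // h; apply: nH; [apply: HA2|apply: HA1].
  move=> A gA; have /choice[H HP] (n : nat) : exists H : set (set E -> \bar R),
      law_events H /\ forall m, counts_atoms m W -> (H m <-> A n (atoms_in m W)).
    by have [H lawH HA] := gA n; exists H.
  exists (\bigcup_n H n); first by apply: lawU => n; have [] := HP n.
  move=> m mW'; have HPn n : H n m <-> A n (atoms_in m W) by have [_] := HP n; apply.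
  by split=> -[n _ /HPn hn]; exists n.
move=> _ [A [n [mA ->]]]; exists ((fun m : set E -> \bar R => m (W `&` A)) @^-1` [set n%:R%:E]).
  apply: sub_sigma_algebra; exists (W `&` A), [set n%:R%:E]; split => //.
  exact: measurableI.
move=> m mW' /=; rewrite mW' //; split=> [[/eqP]|-> //].
by rewrite eqr_nat => /eqP.
Qed.

Lemma translate_set1 (z x : E) : [set y : E | [set x] (y + z)] = [set x - z].
Proof.
by apply/seteqP; split=> y /= => [<-|->]; rewrite ?addrK ?subrK.
Qed.

Lemma atoms_in_translate (m : set E -> \bar R) (z : E) (W : set E) :
  finite_set [set x | W (x + z) /\ (0 < m [set x])%E] ->
  atoms_in (translate_measure z m) W = translate_config z (atoms_in m [set y | W (y + z)]).
Proof.
move=> fin; apply/fsetP => x.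
have imE : [set x | W x /\ (0 < translate_measure z m [set x])%E] =
    (fun y => y + z) @` [set x | W (x + z) /\ (0 < m [set x])%E].
  apply/seteqP; split=> y /=; rewrite /translate_measure.
    by rewrite translate_set1 => yP; exists (y - z); rewrite ?subrK.
  by move=> [u [Wu mu] <-]; rewrite translate_set1 addrK.
rewrite mem_shift /atoms_in imE in_fset_set; last exact: finite_image.
rewrite in_fset_set //; apply/idP/idP => /set_mem h; apply/mem_set.
  by have [y yP <-] := h; rewrite addrK.
by exists (x - z) => //; rewrite subrK.
Qed.

Lemma card_shift_inside (z : E) (A : set E) (Xi : {fset E}) :
  #|` inside A (translate_config z Xi)| = #|` inside [set y | A (y + z)] Xi|.
Proof.
have -> : inside A (translate_config z Xi) = translate_config z (inside [set y | A (y + z)] Xi).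
  apply/fsetP => x; rewrite mem_shift !in_inside mem_shift; congr andb.
  by apply/idP/idP => /set_mem h; apply/mem_set => /=; move: h => /=; rewrite ?subrK.
by rewrite /translate_config card_imfset //=; exact: addIr.
Qed.

Lemma counts_atoms_translate (m : set E -> \bar R) (z : E) (W : set E) :
  finite_set [set x | W (x + z) /\ (0 < m [set x])%E] ->
  counts_atoms m [set y | W (y + z)] -> counts_atoms (translate_measure z m) W.
Proof.
move=> fin mW A mA; rewrite atoms_in_translate // card_shift_inside -mW //.
exact: measurable_translate.
Qed.

Variables (d : measure_display) (T : measurableType d) (Phi : R.-ker T ~> BE).

Lemma measurable_law_event (z : E) (H : set (set E -> \bar R)) : law_events H ->
  measurable [set w | H (translate_measure z (Phi w))].
Proof.
pose good := [set H : set (set E -> \bar R) |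
  measurable [set w | H (translate_measure z (Phi w))]].
suff : @law_events R N `<=` good by apply.
apply: smallest_sub; first split.
- by rewrite /good /= (_ : [set w | _] = set0).
- move=> A mA; rewrite /good /= (_ : [set w | _] = ~` [set w | A (translate_measure z (Phi w))]).
    exact: measurableC.
  by apply/seteqP; split=> w /=; [case|].
- move=> A mA; rewrite /good /=.
  rewrite (_ : [set w | _] = \bigcup_n [set w | A n (translate_measure z (Phi w))]) //.
  exact: bigcupT_measurable.
move=> _ [A [B [mA mB ->]]]; rewrite /good /=.
have := measurable_kernel Phi _ (measurable_translate z mA) measurableT _ mB.
by rewrite setTI.
Qed.

Lemma translate_measure0 (m : set E -> \bar R) : translate_measure 0 m = m.
Proof.
apply/funext => A; rewrite /translate_measure; congr m.
by apply/funext => y /=; rewrite addr0.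
Qed.

End LawEvents.

(** * Tilings of a box by translates of a smaller box *)

Section Grid.
Variables (R : realType) (N : nat).
Local Notation E := 'rV[R]_N.
Local Notation BE := (borel_space R N).

Lemma measurable_box (L : R) : measurable (box L : set BE).
Proof.
apply: measurable_forall => i.
have := @measurable_coord R N i measurableT _ (measurable_itv `[- (L / 2), L / 2[); rewrite setTI.
by congr measurable; apply/seteqP; split=> x /=; rewrite in_itv.
Qed.

Lemma bounded_box (L : R) : bounded_set (box L : set E).
Proof.
apply/bounded_setP; exists `|L| => x xL.
rewrite [leLHS]/Num.Def.normr /= mx_normrE; apply/bigmax_leP; split => // -[i j] _ /=.
rewrite ord1; have /andP[x1 x2] := xL j.
have := ler_norm L; have := ler_norm (- L); rewrite normrN ler_norml; lra.
Qed.

Variables (M k : nat).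
Hypothesis M_gt0 : (0 < M)%N.

(** The cells are the translates of the box of side [M] by the multiples of [M]
    with coordinates from [-k] to [k]. An odd number of cells in each direction
    makes their union exactly a centered box. *)
Definition grid := {ffun 'I_N -> 'I_(2 * k).+1}.

Definition grid_vec (j : grid) : E := \row_i (M%:R * ((j i)%:R - k%:R)).

Definition cell (j : grid) : set E := [set x | box M%:R (x - grid_vec j)].

Definition grid_side : R := (2 * k).+1%:R * M%:R.

Lemma grid_sideE : grid_side = 2 * (k%:R * M%:R) + M%:R.
Proof. by rewrite /grid_side -addn1 natrD natrM mulrDl mul1r mulrA. Qed.

Lemma cell_disjoint (i j : grid) (x : E) : cell i x -> cell j x -> i = j.
Proof.
move=> xi xj; apply/ffunP => a; apply/val_inj.
have := xi a; have := xj a; rewrite !mxE.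
set y := x ord0 a; set m : R := M%:R => /andP[j1 j2] /andP[i1 i2].
have m0 : 0 < m by rewrite ltr0n.
have ij1 : m * (i a)%:R < m * ((j a).+1)%:R by rewrite -natr1 mulrDr mulr1; lra.
have ij2 : m * (j a)%:R < m * ((i a).+1)%:R by rewrite -natr1 mulrDr mulr1; lra.
rewrite !ltr_pM2l // !ltr_nat in ij1 ij2.
by apply/eqP; rewrite eqn_leq; apply/andP; split; rewrite -ltnS.
Qed.

Lemma grid_coord (j : grid) (i : 'I_N) :
  - (k%:R * M%:R) <= grid_vec j ord0 i <= k%:R * M%:R.
Proof.
have m0 : 0 <= M%:R :> R by rewrite ler0n.
have j0 : 0 <= (j i)%:R :> R by rewrite ler0n.
have j2 : (j i)%:R <= 2 * k%:R :> R by rewrite -natrM ler_nat -ltnS.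
rewrite mxE (mulrC k%:R) -mulrN; apply/andP; split; apply: ler_wpM2l => //; lra.
Qed.

Let subE (x y : E) i : (x - y) ord0 i = x ord0 i - y ord0 i.
Proof. by rewrite !mxE. Qed.

Lemma cell_sub_box (j : grid) : cell j `<=` box grid_side.
Proof.
move=> x xj i; have := xj i; rewrite subE; have := grid_coord j i.
rewrite grid_sideE; move: (k%:R * M%:R) (grid_vec j ord0 i) (x ord0 i) => km v y.
have : 0 < M%:R :> R by rewrite ltr0n.
by move=> m0 /andP[j1 j2] /andP[x1 x2]; apply/andP; split; lra.
Qed.

(** Seen from the cell [j], the whole box lies in one window that does not depend
    on [j]; this allows the same event to be used for all cells. *)
Lemma box_sub_window (j : grid) :
  box grid_side `<=` [set x : E | box (2 * grid_side) (x - grid_vec j)].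
Proof.
move=> x xL i; rewrite subE; have := xL i; have := grid_coord j i.
rewrite grid_sideE; move: (k%:R * M%:R) (grid_vec j ord0 i) (x ord0 i) => km v y.
have : 0 < M%:R :> R by rewrite ltr0n.
by move=> m0 /andP[j1 j2] /andP[x1 x2]; apply/andP; split; lra.
Qed.

Lemma box_sub_double : box M%:R `<=` (box (2 * grid_side) : set E).
Proof.
move=> x xM i; have := xM i; rewrite grid_sideE.
have : 0 <= k%:R * M%:R :> R by rewrite mulr_ge0 ?ler0n.
move: (k%:R * M%:R) => km.
have : 0 < M%:R :> R by rewrite ltr0n.
by move=> m0 k0 /andP[x1 x2]; apply/andP; split; lra.
Qed.

Lemma card_grid : #|{: grid}| = ((2 * k).+1 ^ N)%N.
Proof. by rewrite card_ffun !card_ord. Qed.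

End Grid.

(** * Counting the marker cells of a stationary process *)

Section MarkerCount.
Variables (R : realType) (N : nat) (F : fieldType).
Local Notation E := 'rV[R]_N.
Local Notation BE := (borel_space R N).
Variables (kappa : {fset E} -> \bar R) (q : nat).
Hypothesis kappa_adm : admissible kappa.
Variables (d : measure_display) (T : measurableType d) (P : probability T R).
Variable Phi : R.-ker T ~> BE.
Hypotheses (hPhi : is_point_process Phi) (hsimple : simple_process P Phi).
Hypothesis hstat : stationary P Phi.
Variables (I1 I2 : set (\bar R)).
Hypotheses (mI1 : measurable I1) (mI2 : measurable I2).
Variable M : nat.
Hypothesis M_gt0 : (0 < M)%N.

Let A : set (Delta R) := [set p | I1 (birth p) /\ I2 (death p)].

Lemma kappa_ge0 (s : {fset E}) : s != fset0 -> (0 <= kappa s)%E.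
Proof. by case: kappa_adm => _ mono _ _ _ s0; have [] := mono s s s0 (fsubset_refl s). Qed.

Lemma kappa_shift (s : {fset E}) (x : E) : s != fset0 ->
  kappa [fset (y + x)%R | y in s]%fset = kappa s.
Proof. by case: kappa_adm => _ _ + _ _; exact. Qed.

Lemma in_atoms_in w (V : set E) x : measurable (V : set BE) -> bounded_set V ->
  (x \in atoms_in (Phi w) V) = (x \in V) && (0 < Phi w [set x])%E.
Proof.
move=> mV bV; rewrite in_fset_set; last first.
  by apply: finite_atoms => // B mB bB; exact: hPhi.
by apply/idP/andP => [/set_mem[/mem_set]|[/set_mem Vx x0]] //; exact/mem_set.
Qed.

(** The event that the configuration in the window is a relative marker contains
    the marker event up to a null set, hence its probability is at least the
    outer probability of the latter. By stationarity the translated events have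
    the same probability, and when the one of the cell [j] occurs the
    configuration of the big box is a relative marker for that cell. *)
Lemma marker_cells (k : nat) : exists G : grid N k -> set T,
  [/\ forall j, measurable (G j),
      forall j, (mu_ext P [set w | marker F kappa q (box M%:R) A
                   (points_in Phi (box M%:R) w)] <= P (G j))%E &
      forall w, (#|[pred j | w \in G j]|
        <= xi F kappa q (points_in Phi (box (grid_side R M k)) w) A)%N].
Proof.
have [N0 [mN0 PN0 N0P]] := hsimple.
have simple w : ~ N0 w -> forall x : E, (Phi w [set x] <= 1)%E.
  by move=> nw; apply: contrapT => h; apply: nw; exact: N0P.
have int w (B : set E) : measurable (B : set BE) -> bounded_set B ->
    exists n : nat, Phi w B = n%:R%:E by move=> mB bB; exact: hPhi.
(* The window has twice the side of the box, so that it contains the box also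
   after the translation to any cell. *)
pose W : set E := box (2 * grid_side R M k).
have mW : measurable (W : set BE) := @measurable_box R N _.
have bW : bounded_set W := @bounded_box R N _.
have mB (L : R) : measurable (box L : set BE) := @measurable_box R N _.
have bB (L : R) : bounded_set (box L : set E) := @bounded_box R N _.
have kappa_meas : fin_measurable kappa by case: kappa_adm.
have mQ := measurable_relative_marker F q kappa_ge0 kappa_meas (@measurable_box R N M%:R) mI1 mI2.
have [H lawH HQ] := law_event_config mW mQ.
pose HT z := [set w | H (translate_measure z (Phi w))].
have mHT z : measurable (HT z) by exact: measurable_law_event.
have PHT z : P (HT z) = P [set w | H (Phi w)] by exact: hstat.
have HPhi : HT 0 = [set w | H (Phi w)].
  by apply/seteqP; split=> w; rewrite /HT /= translate_measure0.
set c := mu_ext P _.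
have cH : (c <= P [set w | H (Phi w)])%E.
  rewrite -HPhi; apply: (@le_trans _ _ (P (HT 0 `|` N0))); last first.
    apply: le_trans (measureU2 _ _ _) _ => //; by rewrite [X in (_ + X)%E]PN0 adde0.
  rewrite -measurable_mu_extE; last exact: measurableU.
  apply: le_mu_ext => w wm; have [nw|nw] := pselect (N0 w); [by right|left].
  rewrite HPhi /= (HQ (Phi w)); last first.
    by apply: counts_atoms_simple => //; [exact: int|exact: simple].
  apply: marker_relative; move: wm; congr marker.
  apply/fsetP => x; rewrite in_inside /points_in -/(atoms_in (Phi w) _) !in_atoms_in //.
  apply/andP/andP => -[]; last by move=> /andP[_ x0] xM.
  move=> xM x0; split => //; rewrite x0 andbT.
  by apply/mem_set; apply: box_sub_double => //; exact: set_mem.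
exists (fun j => HT (- grid_vec R M j) `\` N0); split=> [j|j|w].
- exact: measurableD.
- apply: le_trans cH _; rewrite -(PHT (- grid_vec R M j)).
  rewrite -[leRHS]adde0 -[X in (_ <= _ + X)%E]PN0.
  apply: le_trans (measureU2 _ _ _) => //; last exact: measurableD.
  apply: le_measure; rewrite ?inE //; first by apply: measurableU => //; exact: measurableD.
  by move=> w; rewrite setDE /=; have [nw|nw] := pselect (N0 w); [right|left].
rewrite cardE; apply: (@leq_relative_marker _ _ _ _ _ _ (@cell R N M k)).
- exact: enum_uniq.
- by move=> i j x; exact: cell_disjoint.
move=> j; rewrite mem_enum => /set_mem[Hj nw].
pose z := grid_vec R M j; pose W' := [set y : E | W (y - z)].
have mW' : measurable (W' : set BE) by exact: measurable_translate.
have bW' : bounded_set W' by exact: bounded_translate.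
have fin : finite_set [set x | W (x - z) /\ (0 < Phi w [set x])%E].
  by apply: (@finite_atoms R N (Phi w) (int w) W').
have cW' : counts_atoms (Phi w) W'.
  by apply: counts_atoms_simple => //; [exact: int|exact: simple].
have := (HQ _ (counts_atoms_translate fin cW')).1 Hj.
rewrite atoms_in_translate // -/W'.
move=> /(relative_marker_shift kappa_ge0 kappa_shift (z := z) (L' := @cell R N M k j)).
move=> /(_ (fun x => iff_refl _)).
have -> : translate_config z (translate_config (- z) (atoms_in (Phi w) W'))
    = atoms_in (Phi w) W'.
  by apply/fsetP => x; rewrite !mem_shift opprK subrK.
apply: relative_markerS; apply/fsubsetP => x.
  rewrite /points_in -/(atoms_in (Phi w) _) !in_atoms_in // => /andP[/set_mem xL ->].
  by rewrite andbT; apply/mem_set; exact: box_sub_window.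
rewrite in_inside /points_in -/(atoms_in (Phi w) _) !in_atoms_in //.
move=> /andP[/andP[_ ->] /set_mem xj]; rewrite andbT.
by apply/mem_set; exact: (cell_sub_box M_gt0 xj).
Qed.

End MarkerCount.

(** * Local compactness of Delta and bump functions *)

Section DeltaTopology.
Variable R : realType.
Local Notation Delta := (Delta R).

(** The extended line is the continuous image of the interval from [-1] to [1]. *)
Lemma ereal_compact : compact [set: \bar R].
Proof.
have -> : [set: \bar R] = (@expand R) @` `[-1, 1]%classic.
  apply/seteqP; split=> // y _; exists (contract y); last exact: contractK.
  by rewrite /= in_itv /= -ler_norml contract_le1.
apply: continuous_compact; last exact: segment_compact.
apply/subspace_continuousP => t t1.
apply/cvg_ballP => e e0; near=> s.
have s1 : `|s| <= 1.
  have : `[-1, 1]%classic s by near: s; exact: withinT.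
  by rewrite /= in_itv ler_norml.
rewrite /ball /= /ereal_ball !expandK ?inE //.
  near: s; apply: cvg_within; exact: nbhsx_ballx.
by rewrite ler_norml; move: t1; rewrite /= in_itv.
Unshelve. all: by end_near.
Qed.

Lemma closed_ereal_le (x : \bar R) : closed [set y | (x <= y)%E].
Proof.
rewrite (_ : [set y | _] = ~` [set y | (y < x)%E]); last first.
  by apply/seteqP; split=> y /=; rewrite leNgt => /negP.
by apply: open_closedC; exact: open_ereal_lt_ereal.
Qed.

Lemma closed_ereal_ge (x : \bar R) : closed [set y | (y <= x)%E].
Proof.
rewrite (_ : [set y | _] = ~` [set y | (x < y)%E]); last first.
  by apply/seteqP; split=> y /=; rewrite leNgt => /negP.
by apply: open_closedC; exact: open_ereal_gt_ereal.
Qed.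

Lemma set_val_continuous : continuous (set_val : Delta -> \bar R * \bar R).
Proof. exact: initial_continuous. Qed.

Lemma nbhs_DeltaP (p : Delta) (A : set Delta) : nbhs p A ->
  exists2 O : set (\bar R * \bar R), open O /\ O (set_val p) &
    set_val @^-1` O `<=` A.
Proof.
rewrite nbhsE => -[U [[OO openO OU] Up] UA]; exists OO.
  by split => //; move: Up; rewrite -OU.
by move=> x Ox; apply: UA; rewrite -OU.
Qed.

(** Delta carries the topology induced by the inclusion, so that the cluster points
    can be found in the product. *)
Lemma compact_Delta (K : set (\bar R * \bar R)) :
  compact K -> K `<=` @Delta_set R -> compact [set p : Delta | K (set_val p)].
Proof.
move=> cK KD F PF FK.
have [|k [Kk kF]] := cK (set_val @ F) _; first exact: FK.
have pD : k \in @Delta_set R by apply/mem_set/KD.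
pose p : Delta := SigSub pD.
exists p; split; first exact: Kk.
move=> A B FA /nbhs_DeltaP[V [openV Vp] VB].
have FsA : (set_val @ F) (set_val @` A).
  by change (F (set_val @^-1` (set_val @` A))); apply: filterS FA => x Ax; exists x.
have [_ [[x Ax <-] Vx]] := kF _ _ FsA (open_nbhs_nbhs (conj openV Vp)).
by exists x; split => //; apply: VB.
Qed.

Lemma ereal_between (x y : \bar R) : (x < y)%E ->
  exists2 m : R, (x < m%:E)%E & (m%:E < y)%E.
Proof.
case: x y => [x| |] [y| |] //= xy.
- exists ((x + y) / 2); rewrite lte_fin; [exact: (midf_lt xy).1|exact: (midf_lt xy).2].
- by exists (x + 1); rewrite ?ltry // lte_fin ltrDl.
- by exists (y - 1); rewrite ?ltNyr // lte_fin ltrBlDr ltrDl.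
- by exists 0; rewrite ?ltry ?ltNyr.
Qed.

(** With reals [birth p < m' < m < death p], the product of the intervals from [0]
    to [m'] and from [m] to infinity is compact and avoids the diagonal. *)
Lemma Delta_locally_compact (p : Delta) :
  exists2 K : set Delta, nbhs p K & compact K.
Proof.
have [b0 bd] : (0 <= birth p)%E /\ (birth p < death p)%E.
  by have := set_valP p.
have [m bm md] := ereal_between bd; have [m' bm' m'm] := ereal_between bm.
pose K := [set x : \bar R | (0 <= x)%E /\ (x <= m'%:E)%E] `*` [set x : \bar R | (m%:E <= x)%E].
exists [set p | K (set_val p)]; last first.
  apply: compact_Delta.
    apply: compact_setX; apply: subclosed_compact ereal_compact _ => //.
      by apply: closedI; [exact: closed_ereal_le|exact: closed_ereal_ge].
    exact: closed_ereal_le.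
  move=> [x y] [/= [x0 xm] my]; split => //=.
  by apply: le_lt_trans xm (lt_le_trans m'm my).
pose B := [set x : \bar R | (x < m'%:E)%E] `*` [set x : \bar R | (m%:E < x)%E].
have pB : nbhs (set_val p) B.
  exists ([set x : \bar R | (x < m'%:E)%E], [set x : \bar R | (m%:E < x)%E]) => //.
  by split; apply: open_nbhs_nbhs; split => //; [exact: open_ereal_lt_ereal|exact: open_ereal_gt_ereal].
have : nbhs p (set_val @^-1` B) by exact: set_val_continuous.
apply: filterS => x [xm mx]; split; last exact: ltW.
split; last exact: ltW.
by have [] := set_valP x.
Qed.

Lemma ereal_nbhs_interval (y : \bar R) (I : set (\bar R)) : nbhs y I ->
  exists J : set (\bar R), [/\ measurable J, nbhs y J & J `<=` I].
Proof.
case: y => [r| |].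
- move=> rI; have /nbhs_ballP[e /= e0 eI] : nbhs r [set x : R | I x%:E] := rI.
  exists [set y | ((r - e)%:E < y)%E /\ (y < (r + e)%:E)%E]; split.
  + rewrite (_ : [set y | _] = `](r - e)%:E, (r + e)%:E[%classic).
      exact: emeasurable_itv.
    by apply/seteqP; split=> y /=; rewrite in_itv /=; [move=> [-> ->]|move=> /andP[-> ->]].
  + have h1 : nbhs r%:E (fun y => ((r - e)%:E < y)%E).
      by apply: open_ereal_gt'; rewrite lte_fin ltrBlDr ltrDl.
    have h2 : nbhs r%:E (fun y => (y < (r + e)%:E)%E).
      by apply: open_ereal_lt'; rewrite lte_fin ltrDl.
    by apply: filterS (filterI h1 h2) => y [].
  case=> [s| |] /= [rs sr]; last 2 first.
  + by move: sr; rewrite ltNge leey.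
  + by move: rs; rewrite ltNge leNye.
  by apply: eI; rewrite -ball_normE /= ltr_distlC; move: rs sr; rewrite !lte_fin => -> ->.
- move=> [M [Mr MI]]; exists [set y | (M%:E < y)%E]; split => //.
    have -> : [set y | (M%:E < y)%E] = `]M%:E, +oo[%classic.
      by apply/seteqP; split=> y /=; rewrite in_itv /= andbT.
    exact: emeasurable_itv.
  by exists M.
- move=> [M [Mr MI]]; exists [set y | (y < M%:E)%E]; split => //.
    have -> : [set y | (y < M%:E)%E] = `]-oo, M%:E[%classic.
      by apply/seteqP; split=> y /=; rewrite in_itv.
    exact: emeasurable_itv.
  by exists M.
Qed.

Variable dist : Delta -> Delta -> R.
Hypothesis dist_metric : metric_on_Delta dist.

Lemma dist_continuous (p : Delta) : continuous (dist p).
Proof.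
have [d0 deq dsym dtri dnbhs] := dist_metric.
move=> x; apply/(@cvgrPdist_lt _ _ _ _ (@nbhs_filter Delta x)) => e e0; apply/dnbhs; exists e => // y /= xy.
rewrite ltr_norml; apply/andP; split.
  by have := dtri p x y; lra.
by have := dtri p y x; rewrite (dsym y x); lra.
Qed.

(** The distance to [p] cut off at a small height is a bump function. Rectangles
    of births and deaths are used for the set on which it is large, because they
    give measurable conditions on the values of [kappa]. *)
Lemma bump_function (p : Delta) (U : set Delta) : open U -> U p ->
  exists (f : Delta -> R) (I1 I2 : set (\bar R)) (e : R),
    [/\ [/\ continuous f, compact (closure [set x | f x != 0]),
             forall x, 0 <= f x <= 2 & forall x, f x != 0 -> U x],
        measurable I1, measurable I2,
        forall x, I1 (birth x) -> I2 (death x) -> 1 <= f x &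
        0 < e /\ forall x, dist p x < e -> I1 (birth x) /\ I2 (death x)].
Proof.
move=> openU Up; have [d0 deq dsym dtri dnbhs] := dist_metric.
have [K pK cK] := Delta_locally_compact p.
have /dnbhs[h h0 hKU] : nbhs p (K `&` U).
  by apply: filterI => //; apply: open_nbhs_nbhs.
(* The function vanishes at distance [h / 2] from [p] and is at least 1 up to
   distance [h / 4]. *)
pose f x := Num.max 0 (2 - (4 / h) * dist p x).
have fcont : continuous f.
  apply: (@max_fun_continuous _ Delta R (cst 0) (fun x => 2 - (4 / h) * dist p x)).
    exact: cst_continuous.
  move=> x; apply: (@continuousB _ R^o _ (cst 2) (fun x => (4 / h) * dist p x)).
    exact: cst_continuous.
  apply: (@continuousM _ _ (cst (4 / h)) (dist p)); first exact: cst_continuous.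
  exact: dist_continuous.
have f_neq0 x : f x != 0 -> dist p x <= h / 2.
  apply: contraNT; rewrite -ltNge => hx; rewrite /f max_l //.
  rewrite subr_le0 mulrAC ler_pdivlMr //; lra.
have fK : closure [set x | f x != 0] `<=` [set x | dist p x <= h / 2].
  rewrite closureE => x; apply; split => //.
  by have /continuous_closedP := @dist_continuous p; move=> /(_ _ (@closed_le R (h / 2))).
have f_ge1 : nbhs p [set x | 1 <= f x].
  apply/dnbhs; exists (h / 4); first by lra.
  move=> x /= xh; rewrite /f le_max; apply/orP; right.
  rewrite lerBrDr addrC -lerBrDr mulrAC ler_pdivrMr //; lra.
have [V [openV Vp] Vf] := nbhs_DeltaP f_ge1.
have [[J1 J2] /= [nJ1 nJ2] JV] := open_nbhs_nbhs (conj openV Vp).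
have [I1 [mI1 pI1 IJ1]] := ereal_nbhs_interval nJ1.
have [I2 [mI2 pI2 IJ2]] := ereal_nbhs_interval nJ2.
have /dnbhs[e e0 eI] : nbhs p (set_val @^-1` (I1 `*` I2)).
  by apply: set_val_continuous; exists (I1, I2).
exists f, I1, I2, e; split => //; first split => //.
- apply: subclosed_compact cK _; first exact: closed_closure.
  move=> x /fK /= xh; have [] : (K `&` U) x => //.
  by apply: hKU; rewrite /=; lra.
- move=> x; rewrite /f le_max lexx /= ge_max; apply/andP; split; first by lra.
  by rewrite gerBl mulr_ge0 // divr_ge0 // ltW.
- move=> x /f_neq0 xh; have [] : (K `&` U) x => //.
  by apply: hKU; rewrite /=; lra.
- move=> x x1 x2; apply: (Vf x); apply: JV; split; [exact: IJ1|exact: IJ2].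
Qed.

End DeltaTopology.

(** * Lower bound for the limit measure *)

(** The integral of a nonnegative function is a supremum over the simple functions
    below it, which is monotone without any measurability; the number of points
    of a random diagram is only used in this form. *)
Lemma ge0_le_integral_nonmeasurable (R : realType) (d : measure_display)
    (T : measurableType d) (mu : {measure set T -> \bar R}) (f g : T -> \bar R) :
  (forall x, 0 <= f x)%E -> (forall x, f x <= g x)%E ->
  (\int[mu]_x f x <= \int[mu]_x g x)%E.
Proof.
move=> f0 fg; have g0 x : (0 <= g x)%E by apply: le_trans (fg x).
rewrite !ge0_integralTE //; apply: le_ereal_sup => _ [h hf <-].
by exists h => // x; apply: le_trans (fg x).
Qed.

Lemma integral_ge_count (R : realType) (d : measure_display) (T : measurableType d)
    (P : probability T R) (J : finType) (G : J -> set T) (Y : T -> R) (c : R) :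
  (forall j, measurable (G j)) -> (forall j, c%:E <= P (G j))%E ->
  (forall w, (#|[pred j | w \in G j]|)%:R <= Y w) ->
  ((#|J|%:R * c)%:E <= \int[P]_w (Y w)%:E)%E.
Proof.
move=> mG cG GY.
apply: (@le_trans _ _ (\int[P]_w (\sum_(j <- enum J) (\1_(G j) w)%:E))%E).
  rewrite ge0_integral_sum //; last first.
    by move=> j; apply/measurable_EFinP; exact: measurable_indic.
  rewrite (eq_bigr (fun j => P (G j))); last first.
    by move=> j _; rewrite integral_indic // setIT.
  apply: (@le_trans _ _ (\sum_(j <- enum J) c%:E)%E); last exact: lee_sum.
  by rewrite sumEFin big_const_seq count_predT iter_addr addr0 -cardE mulr_natl.
apply: ge0_le_integral_nonmeasurable => w.
  by apply: sume_ge0 => j _; rewrite lee_fin.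
apply: le_trans (_ : (#|[pred j | w \in G j]|)%:R%:E <= _)%E; last by rewrite lee_fin.
rewrite sumEFin lee_fin big_enum /= -sum1_card natr_sum [leRHS]big_mkcond /=.
by apply: ler_sum => j _; rewrite indicE inE; case: (w \in G j).
Qed.

Lemma le_count_sum (R : numDomainType) (I : Type) (s : seq I) (a : pred I) (f : I -> R) :
  (forall x, 0 <= f x) -> (forall x, a x -> 1 <= f x) ->
  (count a s)%:R <= \sum_(x <- s) f x.
Proof.
move=> f0 f1; elim: s => [|x s IH]; first by rewrite big_nil.
rewrite big_cons /= natrD lerD //; case: (boolP (a x)) => [/f1 //|_]; exact: f0.
Qed.

(** The function is at most twice the indicator of [U]. *)
Lemma measure_gt0_of_integral (R : realType) (nu : {measure set borel_Delta R -> \bar R})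
    (U : set (Delta R)) (f : Delta R -> R) :
  open U -> (forall x, 0 <= f x <= 2) -> (forall x, f x != 0 -> U x) ->
  (0 < \int[nu]_x (f x)%:E)%E -> (0 < nu U)%E.
Proof.
move=> openU f02 fU; apply: contraTT; rewrite -!leNgt => nuU.
have mU : measurable (U : set (borel_Delta R)) by exact: sub_sigma_algebra.
apply: (@le_trans _ _ (\int[nu]_x (2%:E * (\1_U x)%:E))%E).
  apply: ge0_le_integral_nonmeasurable => x.
    by rewrite lee_fin; have /andP[] := f02 x.
  have /andP[f0 f2] := f02 x; rewrite -EFinM lee_fin indicE.
  have [fx|/fU Ux] := eqVneq (f x) 0; first by rewrite fx mulr_ge0.
  by rewrite mem_set // mulr1.
rewrite ge0_integralZl_EFin //; last first.
  by apply/measurable_EFinP; exact: measurable_indic.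
by rewrite integral_indic // setIT mule_ge0_le0 // lee_fin.
Qed.

Theorem theorem4p7 (R : realType) (N : nat) (hN : (1 <= N)%N) (q : nat)
    (F : fieldType)
    (kappa : {fset 'rV[R]_N} -> \bar R) (hkappa : admissible kappa)
    (dist : Delta R -> Delta R -> R) (hdist : metric_on_Delta dist)
    (d : measure_display) (T : measurableType d) (P : probability T R)
    (Phi : R.-ker T ~> borel_space R N)
    (hPhi : is_point_process Phi) (hsimple : simple_process P Phi)
    (hstat : stationary P Phi) (hmom : all_moments P Phi)
    (nu : {measure set borel_Delta R -> \bar R})
    (hnu : is_limit_measure P Phi F kappa q nu) :
  S_q P Phi F kappa q dist `<=` supp nu.
Proof.
move=> p pS U openU Up.
have [f [I1 [I2 [e [[fcont fK f02 fU] mI1 mI2 fA [e0 eI]]]]]] :=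
  bump_function hdist openU Up.
pose A : set (Delta R) := [set x | I1 (birth x) /\ I2 (death x)].
pose ev (M : nat) := [set w | marker F kappa q (box M%:R) A (points_in Phi (box M%:R) w)].
have [M M0 evM] : exists2 M : nat, (0 < M)%N & (0 < mu_ext P (ev M))%E.
  apply: contrapT => noM; have := pS e e0; rewrite /S_eps /= ltNge => /negP; apply.
  apply: (@le_trans _ _ (mu_ext P (\bigcup_n ev n.+1))).
    apply: le_mu_ext => w [[//|M] _ [p' p'e p'M]]; exists M => //.
    by exists p' => //; exact: eI.
  apply: le_trans (mu_ext_sigma_subadditive (measure_ge0 P) _) _.
  rewrite eseries0 // => n _ _; apply/eqP; rewrite eq_le.
  rewrite (mu_ext_ge0 (measure_ge0 P)) andbT leNgt.
  by apply/negP => nM; apply: noM; exists n.+1.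
have [c c0 cM] := ereal_between evM; rewrite lte_fin in c0.
apply: (measure_gt0_of_integral openU f02 fU).
have lower k : ((M%:R ^- N * c)%:E <=
    ((grid_side R M k) ^- N)%:E * expected_xi P Phi F kappa q (grid_side R M k) f)%E.
  have [G [mG PG GY]] := marker_cells F q hkappa hPhi hsimple hstat mI1 mI2 M0 k.
  have side0 : 0 < grid_side R M k by rewrite mulr_gt0 // ltr0n.
  have -> : (M%:R ^- N * c)%:E =
      (((grid_side R M k) ^- N)%:E * ((#|{: grid N k}|)%:R * c)%:E)%E.
    rewrite -EFinM card_grid natrX /grid_side exprMn invfM mulrA; congr (_ * c)%:E.
    by rewrite mulrAC mulVf ?mul1r // expf_neq0 // pnatr_eq0.
  apply: lee_wpmul2l; first by rewrite lee_fin invr_ge0 exprn_ge0 // ltW.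
  apply: (integral_ge_count mG) => [j|w].
    by apply: le_trans (PG j); exact: ltW.
  apply: (@le_trans _ _ (xi F kappa q (points_in Phi (box (grid_side R M k)) w) A)%:R).
    by rewrite ler_nat; exact: GY.
  apply: le_count_sum => x; first by have /andP[] := f02 x.
  by move=> /set_mem[x1 x2]; exact: fA.
have [_ /(_ f fcont fK) lim] := hnu.
apply: (@lt_le_trans _ _ (M%:R ^- N * c)%:E).
  by rewrite lte_fin mulr_gt0 // invr_gt0 exprn_gt0 // ltr0n.
rewrite leNgt; apply/negP => small.
have : nbhs (\int[nu]_x (f x)%:E)%E [set y | (y < (M%:R ^- N * c)%:E)%E].
  by apply: open_nbhs_nbhs; split => //; exact: open_ereal_lt_ereal.
move=> /lim [L0 [_ L0P]].
(* The side of the box is at least [k], so it exceeds [L0] for this [k]. *)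
pose k := Num.bound `|L0|.
have := lower k; rewrite leNgt => /negP; apply; apply: L0P.
have := archi_boundP (normr_ge0 L0); rewrite -/k => L0k.
rewrite (le_lt_trans (ler_norm _)) // (lt_le_trans L0k) // /grid_side.
rewrite -natrM ler_nat; nia.
Qed.
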